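(* Let $\phi$ be a branching mechanism and let $\{x(t):t\ge 0\}$ under $\mathbf{Q}_x$ be a Hunt realization of the CB-process with branching mechanism $\phi$ started at time zero from $x$. Let $\phi'(\infty)=\lim_{z\to\infty}\phi'(z)\in(-\infty,\infty]$. If $\phi'(\infty)>0$, then for $x>0$ and $\theta>0$ we have $$\mathbf{Q}_x\exp\bigg\{-\theta\int_0^\infty x(s)\,ds\bigg\}=\exp\{-x\phi^{-1}(\theta)\}$$ and $$\mathbf{Q}_x\bigg\{\int_0^\infty x(s)\,ds<\infty\bigg\}=\exp\{-x\phi^{-1}(0)\},$$ where $\phi^{-1}(\theta)=\inf\{z\ge 0:\phi(z)>\theta\}$ for $\theta>0$ and $\phi^{-1}(0)=\inf\{z>0:\phi(z)\ge 0\}$. If $\phi'(\infty)\le 0$, then for any $x>0$ we have $$\mathbf{Q}_x\bigg\{\int_0^\infty x(s)\,ds<\infty\bigg\}=0 .$$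
   Context: A branching mechanism is a function $\phi(z)=bz+cz^2+\int_{(0,\infty)}(e^{-zu}-1+zu)\,m(du)$, $z\ge 0$, with $b\in\mathbb{R}$, $c\ge 0$ and $m$ a $\sigma$-finite measure on $(0,\infty)$ with $\int_{(0,\infty)}(u\wedge u^2)\,m(du)<\infty$. For $\lambda\ge 0$ let $t\mapsto v_t(\lambda)$ be the unique nonnegative solution of $v_t(\lambda)=\lambda-\int_0^t\phi(v_s(\lambda))\,ds$; the CB-process with branching mechanism $\phi$ is the Markov process in $[0,\infty)$ with (Feller) transition semigroup $(Q_t)_{t\ge 0}$ given by $\int_{[0,\infty)}e^{-\lambda y}Q_t(x,dy)=e^{-xv_t(\lambda)}$. A Hunt realization is in particular càdlàg. $\mathbf{Q}_x$ applied to a random variable denotes its expectation. *)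

(* Defs.v *)
From HB Require Import structures.
From mathcomp Require Import all_boot all_order all_algebra.
From mathcomp Require Import all_classical all_reals all_analysis.

Set Implicit Arguments.
Unset Strict Implicit.
Unset Printing Implicit Defensive.
Import Order.TTheory GRing.Theory Num.Theory.
Import numFieldNormedType.Exports.
Local Open Scope classical_set_scope.
Local Open Scope ring_scope.

(* The state space [0, oo) and the time axis [0, oo) are
   both represented by R, every condition being restricted to nonnegative
   arguments. *)

(* Only the restriction of m to (0, oo) is used, and only the values of phi on
   [0, oo) are prescribed. *)
Definition is_branching_mechanism (R : realType) (phi : R -> R) : Prop :=
  exists (b c : R) (m : {measure set R -> \bar R}),
    [/\ 0 <= c,
        sigma_finite (`]0, +oo[%classic : set R) m,
        (\int[m]_(u in `]0%R, +oo[) (Num.min u (u ^+ 2))%:E < +oo)%E &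
        forall z : R, 0 <= z ->
          phi z = b * z + c * z ^+ 2
            + \int[m]_(u in `]0, +oo[) (expR (- (z * u)) - 1 + z * u)].

(* lim is total; here the limit exists because phi is convex. *)
Definition dphi_infty (R : realType) (phi : R -> R) : \bar R :=
  lim ((derive1 phi z)%:E @[z --> +oo%R]).

Definition phi_inv (R : realType) (phi : R -> R) (theta : R) : R :=
  if theta == 0 then inf [set z | 0 < z /\ 0 <= phi z]
  else inf [set z | 0 <= z /\ theta < phi z].

(* u is the solution t |-> v_t(lambda).  Integrability is part of the meaning
   of the equation, since Rintegral is total. *)
Definition is_cumulant (R : realType) (phi : R -> R) (lambda : R)
    (u : R -> R) : Prop :=
  forall t : R, 0 <= t ->
    [/\ 0 <= u t,
        lebesgue_measure.-integrable `[0, t] (fun s => (phi (u s))%:E) &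
        u t = lambda - \int[lebesgue_measure]_(s in `[0, t]) phi (u s)].

Record is_cb_semigroup (R : realType) (phi : R -> R)
    (P : R -> R.-pker R ~> R) : Prop := {
  cb_support : forall t x : R, 0 <= t -> 0 <= x -> P t x (`[0, +oo[%classic : set R) = 1%E;
  cb_chapman_kolmogorov : forall (s t x : R) (B : set R),
    0 <= s -> 0 <= t -> 0 <= x -> measurable B ->
    P (s + t) x B = (\int[P s x]_(y in `[0%R, +oo[) P t y B)%E;
  cb_laplace : exists v : R -> R -> R,
    forall lambda : R, 0 <= lambda ->
      is_cumulant phi lambda (v^~ lambda) /\
      forall t x : R, 0 <= t -> 0 <= x ->
        (\int[P t x]_(y in `[0%R, +oo[) (expR (- (lambda * y)))%:E
         = (expR (- (x * v t lambda)))%:E)%E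
}.

Definition is_filtration (R : realType) d (Omega : measurableType d)
    (F : R -> set (set Omega)) : Prop :=
  [/\ forall t : R, 0 <= t -> sigma_algebra setT (F t),
      forall t : R, 0 <= t -> F t `<=` measurable &
      forall s t : R, 0 <= s -> s <= t -> F s `<=` F t].

(* Optional times and the sigma-algebra F_{T+}: these are the stopping times
   and the sigma-algebra F_T of the filtration (F_{t+}), so that (F_t) itself
   need not be right-continuous. *)
Definition is_optional (R : realType) d (Omega : measurableType d)
    (F : R -> set (set Omega)) (T : Omega -> \bar R) : Prop :=
  (forall w, (0 <= T w)%E) /\
  (forall t : R, 0 < t -> F t [set w | (T w < t%:E)%E]).

Definition optional_sigma (R : realType) d (Omega : measurableType d)
    (F : R -> set (set Omega)) (T : Omega -> \bar R) : set (set Omega) :=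
  [set A | measurable A /\
    forall t : R, 0 < t -> F t (A `&` [set w | (T w < t%:E)%E])].

Definition cadlag (R : realType) (f : R -> R) : Prop :=
  (forall t : R, 0 <= t -> f s @[s --> t^'+] --> f t) /\
  (forall t : R, 0 < t -> exists l : R, f s @[s --> t^'-] --> l).

Record is_markov_realization (R : realType) d (Omega : measurableType d)
    (P : R -> R.-pker R ~> R) (F : R -> set (set Omega))
    (X : R -> Omega -> R) (Q : R -> probability Omega R) : Prop := {
  markov_filtration : is_filtration F;
  markov_adapted : forall (t : R) (B : set R), 0 <= t -> measurable B ->
    F t (X t @^-1` B);
  markov_state : forall (t : R) (w : Omega), 0 <= t -> 0 <= X t w;
  markov_start : forall x : R, 0 <= x -> Q x [set w | X 0 w = x] = 1%E;
  markov_property : forall (x s t : R) (A : set Omega) (B : set R),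
    0 <= x -> 0 <= s -> 0 <= t -> F s A -> measurable B ->
    Q x (A `&` X (s + t) @^-1` B) = (\int[Q x]_(w in A) P t (X s w) B)%E
}.

Record is_hunt_realization (R : realType) d (Omega : measurableType d)
    (P : R -> R.-pker R ~> R) (F : R -> set (set Omega))
    (X : R -> Omega -> R) (Q : R -> probability Omega R) : Prop := {
  hunt_markov : is_markov_realization P F X Q;
  hunt_cadlag : forall w, cadlag (X^~ w);
  hunt_strong_markov : forall (x t : R) (T : Omega -> \bar R) (A : set Omega)
      (B : set R),
    0 <= x -> 0 <= t -> is_optional F T -> optional_sigma F T A ->
    measurable B ->
    Q x (A `&` [set w | (T w < +oo)%E /\ B (X (fine (T w) + t) w)])
    = (\int[Q x]_(w in A `&` [set w | T w < +oo])
         P t (X (fine (T w)) w) B)%E;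
  hunt_quasi_left_continuous : forall (x : R) (Tn : nat -> Omega -> \bar R)
      (T : Omega -> \bar R),
    0 <= x -> (forall n, is_optional F (Tn n)) ->
    (forall n w, (Tn n w <= Tn n.+1 w)%E) ->
    (forall w, Tn n w @[n --> \oo] --> T w) ->
    {ae Q x, forall w, (T w < +oo)%E ->
      X (fine (Tn n w)) w @[n --> \oo] --> X (fine (T w)) w}
}.

Definition total_mass (R : realType) (Omega : Type) (X : R -> Omega -> R)
    (w : Omega) : \bar R :=
  (\int[lebesgue_measure]_(s in `[0%R, +oo[) (X s w)%:E)%E.

(* Main.v *)
(* For every step [h] and every [z >= 0], with [delta := z - v_h(z)], the
   Markov property makes
     [exp(- z x(nh) - delta * (x(0) + ... + x((n-1)h)))]
   an exact discrete martingale of mean [exp(- x z)].  As [h] tends to 0,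
   [delta / h] tends to [phi z] and [h * sum_j x(jh)] tends to the integral of
   the path, because paths are cadlag.  Write [A_N] for the integral of [x] over
   [0, N].  Bounding the martingale from above gives, when [phi z > 0],
     [exp(- x z) <= E exp(- phi(z) A_N)].
   Averaging its values along the grid and using Jensen's inequality for
   [y |-> exp(- y)] gives
     [E exp(- (max(phi z, 0) + z / N) A_N) <= exp(- x z)],
   and the additional [z / N] disappears as [N] tends to infinity.  Taking [z]
   with [phi z = theta] yields the Laplace transform of the total mass, and
   [theta -> 0] the probability that it is finite.  If [phi'(oo) <= 0], then
   [phi <= 0], so the second bound says
     [Q_x (total mass < oo) <= exp(- x z)] for every [z > 0]. *)

Require Import Defs.
From HB Require Import structures.
From mathcomp Require Import all_boot all_order all_algebra.
From mathcomp Require Import all_classical all_reals all_analysis.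
From mathcomp Require Import measurable_realfun ring lra.
Set Implicit Arguments.
Unset Strict Implicit.
Unset Printing Implicit Defensive.
Import Order.TTheory GRing.Theory Num.Theory.
Import numFieldNormedType.Exports.
Local Open Scope classical_set_scope.
Local Open Scope ring_scope.

(** * Branching mechanisms *)

(** Jump integrand of [phi]. The argument [z] comes first so that [partial1of2] differentiates in
    it. *)
Definition levy_kernel {R : realType} (z u : R) : R :=
  expR (- (z * u)) - 1 + z * u.

(** * Integrals of the kernel against the jump measure *)

Section levy_integral.
Context {R : realType} {m : {measure set R -> \bar R}}.
Hypothesis hm : (\int[m]_(u in `]0%R, +oo[) (Num.min u (u ^+ 2))%:E < +oo)%E.

Local Notation D := (`]0, +oo[%classic : set R).

Lemma one_sub_expRN_le (x : R) : 1 - expR (- x) <= x.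
Proof. by have := expR_ge1Dx (- x); lra. Qed.

(** Follows from [1 + x <= expR x] and [(1 - x + x ^+ 2) * (1 + x) = 1 + x ^+ 3 >= 1]. *)
Lemma expRN_le_quad (x : R) : 0 <= x -> expR (- x) <= 1 - x + x ^+ 2.
Proof.
move=> x0; rewrite expRN -[leLHS]mul1r ler_pdivrMr ?expR_gt0//.
have h1 : 1 <= (1 - x + x ^+ 2) * (1 + x).
  have -> : (1 - x + x ^+ 2) * (1 + x) = 1 + x ^+ 3 by ring.
  by rewrite lerDl exprn_ge0.
apply: (le_trans h1); rewrite ler_wpM2l ?expR_ge1Dx//; nra.
Qed.

Lemma levy_kernel_ge0 (z u : R) : 0 <= levy_kernel z u.
Proof. by rewrite /levy_kernel; have := expR_ge1Dx (- (z * u)); lra. Qed.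

Lemma min_sqr_ge0 (u : R) : 0 <= u -> 0 <= Num.min u (u ^+ 2).
Proof. by move=> u0; rewrite le_min u0 sqr_ge0. Qed.

Lemma le_mul_min_sqr (C u y : R) : 0 <= u -> y <= C * u -> y <= C * u ^+ 2 ->
  y <= C * Num.min u (u ^+ 2).
Proof. by move=> u0 h1 h2; rewrite /Num.min; case: ifP. Qed.

(** Bounding the exponential by 1 gives [z * u], by its quadratic majorant [z ^+ 2 * u ^+ 2]; the
    sum of the two constants serves both branches of the minimum. *)
Lemma levy_kernel_le (z u : R) : 0 <= z -> 0 <= u ->
  levy_kernel z u <= (z + z ^+ 2) * Num.min u (u ^+ 2).
Proof.
move=> z0 u0; have zu0 : 0 <= z * u by rewrite mulr_ge0.
have e1 : expR (- (z * u)) <= 1 by rewrite -expR0 ler_expR; lra.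
have e2 := expRN_le_quad zu0.
have z20 : 0 <= z ^+ 2 by rewrite sqr_ge0.
apply: le_mul_min_sqr => //; rewrite /levy_kernel; nra.
Qed.

Lemma deriv_levy_kernel_le (z u : R) : 0 <= z -> 0 <= u ->
  u * (1 - expR (- (z * u))) <= (1 + z) * Num.min u (u ^+ 2).
Proof.
move=> z0 u0; have e1 := one_sub_expRN_le (z * u).
have e2 := expR_gt0 (- (z * u)).
by apply: le_mul_min_sqr => //; nra.
Qed.

Lemma measurable_min_sqr : measurable_fun D (fun u => Num.min u (u ^+ 2)).
Proof.
apply: (measurable_funS measurableT) => //.
by apply: measurable_minr => //; exact: exprn_measurable.
Qed.

Lemma integrable_min_sqr : m.-integrable D (fun u => (Num.min u (u ^+ 2))%:E).
Proof.
apply/integrableP; split; first by apply/measurable_EFinP; exact: measurable_min_sqr.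
apply: le_lt_trans hm; rewrite le_eqVlt; apply/orP; left; apply/eqP.
apply: eq_integral => u; rewrite inE /D /= in_itv/= andbT => u0.
by rewrite ger0_norm// min_sqr_ge0// ltW.
Qed.

Lemma integrable_le_min_sqr (f : R -> R) (C : R) : measurable_fun setT f ->
  (forall u, 0 < u -> 0 <= f u <= C * Num.min u (u ^+ 2)) ->
  m.-integrable D (EFin \o f).
Proof.
move=> mf fC.
have := integrableZl (measurable_itv `]0, +oo[) C integrable_min_sqr.
apply: le_integrable => //.
  by apply/measurable_EFinP; exact: measurable_funS mf.
move=> u; rewrite /= in_itv/= andbT => u0.
have /andP[f0 fl] := fC _ u0.
by rewrite lee_fin ger0_norm// (le_trans fl)// ler_norm.
Qed.

Lemma measurable_levy_kernel (z : R) : measurable_fun setT (levy_kernel z).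
Proof.
apply: continuous_measurable_fun => u; rewrite /levy_kernel.
apply: cvgD; last by apply: cvgM; [exact: cvg_cst|exact: cvg_id].
apply: cvgB; last exact: cvg_cst.
apply: (@continuous_comp _ _ _ (fun u => - (z * u)) expR); last exact: continuous_expR.
by apply: cvgN; apply: cvgM; [exact: cvg_cst|exact: cvg_id].
Qed.

Lemma integrable_levy_kernel (z : R) : 0 <= z -> m.-integrable D (EFin \o levy_kernel z).
Proof.
move=> z0; apply: (@integrable_le_min_sqr _ (z + z ^+ 2)).
  exact: measurable_levy_kernel.
by move=> u u0; rewrite levy_kernel_ge0/= levy_kernel_le// ltW.
Qed.

Lemma is_derive_levy_kernel (z u : R) :
  is_derive z (1 : R) (levy_kernel^~ u) (u * (1 - expR (- (z * u)))).
Proof.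
rewrite /levy_kernel.
have -> : (fun z => expR (- (z * u)) - 1 + z * u) =
          (fun z => (expR \o (fun z => - (z * u))) z - 1 + z * u) by [].
apply: is_derive_eq.
rewrite /GRing.scale/=; ring.
Qed.

Lemma partial1_levy_kernel (z u : R) :
  partial1of2 levy_kernel z u = u * (1 - expR (- (z * u))).
Proof.
by rewrite partial1of2E; have /@derive_val -> := is_derive_levy_kernel z u.
Qed.

(** Differentiation under the integral sign on the neighbourhood []0, z + 1[] of [z], where the
    constant [1 + x] of [deriv_levy_kernel_le] stays below [2 + z]. *)
Lemma is_derive_Rintegral_levy_kernel (z : R) : 0 < z ->
  is_derive z (1 : R) (fun z => \int[m]_(u in D) levy_kernel z u)
    (\int[m]_(u in D) (u * (1 - expR (- (z * u))))).
Proof.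
move=> z0.
have Iz : `]0, (z + 1)[%classic z by rewrite /= in_itv/= z0/= ltrDl ltr01.
have mD : measurable D by exact: measurable_itv.
have int x : `]0, (z + 1)[%classic x -> m.-integrable D (EFin \o levy_kernel x).
  by rewrite /= in_itv/= => /andP[x0 _]; apply/integrable_levy_kernel/ltW.
have der x y : `]0, (z + 1)[%classic x -> D y -> derivable (levy_kernel ^~ y) x 1.
  by move=> _ _; have [] := is_derive_levy_kernel x y.
(* The absolute value keeps the dominating function nonnegative on the whole line: the minimum is
   negative for [u < 0]. *)
have G0 u : 0 <= (2 + z) * `|Num.min u (u ^+ 2)|.
  by rewrite mulr_ge0 ?normr_ge0//; lra.
have intG : m.-integrable D (EFin \o (fun u => (2 + z) * `|Num.min u (u ^+ 2)|)).
  exact: (integrableZl mD (2 + z) (integrable_norm integrable_min_sqr)).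
have Gub x y : `]0, (z + 1)[%classic x -> D y ->
    `|partial1of2 levy_kernel x y| <= (2 + z) * `|Num.min y (y ^+ 2)|.
  rewrite /= !in_itv/= andbT => /andP[x0 xz] y0; rewrite partial1_levy_kernel.
  have e1 : expR (- (x * y)) <= 1 by rewrite -expR0 ler_expR; nra.
  rewrite ger0_norm; last by apply: mulr_ge0; lra.
  apply: (le_trans (deriv_levy_kernel_le (ltW x0) (ltW y0))).
  have m0 := min_sqr_ge0 (ltW y0).
  rewrite (ger0_norm m0) ler_wpM2r//; lra.
apply: DeriveDef.
  exact: (derivable_under_integral mD Iz int der G0 intG Gub).
rewrite -derive1E (differentiation_under_integral mD Iz int der G0 intG Gub).
by apply: eq_Rintegral => u _; rewrite partial1_levy_kernel.
Qed.

Lemma nondecreasing_Rintegral_deriv_levy_kernel (x y : R) : 0 < x -> x <= y ->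
  \int[m]_(u in D) (u * (1 - expR (- (x * u)))) <=
  \int[m]_(u in D) (u * (1 - expR (- (y * u)))).
Proof.
have int z : 0 < z ->
    m.-integrable D (EFin \o (fun u => u * (1 - expR (- (z * u))))).
  move=> z0; apply: (@integrable_le_min_sqr _ (1 + z)).
    apply: continuous_measurable_fun => u.
    apply: cvgM; first exact: cvg_id.
    apply: cvgB; first exact: cvg_cst.
    apply: (@continuous_comp _ _ _ (fun u => - (z * u)) expR);
      last exact: continuous_expR.
    by apply: cvgN; apply: cvgM; [exact: cvg_cst|exact: cvg_id].
  move=> u u0; rewrite (deriv_levy_kernel_le (ltW z0) (ltW u0)) andbT mulr_ge0 ?(ltW u0)// subr_ge0.
  by rewrite -expR0 ler_expR; nra.
move=> x0 xy; apply: le_Rintegral => //.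
- exact: (int _ x0).
- exact: (int _ (lt_le_trans x0 xy)).
- move=> u; rewrite /= in_itv/= andbT => u0.
  by rewrite ler_wpM2l ?(ltW u0)// lerB// ler_expR; nra.
Qed.

Lemma chord_levy_kernel_gt0 (p y u : R) : 0 < p -> p < y -> 0 < u ->
  0 < p * levy_kernel y u - y * levy_kernel p u.
Proof.
move=> p0 py u0; rewrite /levy_kernel.
set a := expR (- (p * u)).
have a0 : 0 < a by exact: expR_gt0.
have pu : 0 < p * u by rewrite mulr_gt0.
(* Strict convexity of [expR]: compare the values at [- y u] and [0] with the
   tangent at [- p u]. *)
have e1 : a * (1 - (y - p) * u) <= expR (- (y * u)).
  have -> : - (y * u) = - (p * u) - (y - p) * u by ring.
  rewrite expRD -/a ler_wpM2l ?(ltW a0)//.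
  by have := expR_ge1Dx (- ((y - p) * u)); lra.
have e2 : a * (1 + p * u) < 1.
  rewrite /a expRN mulrC ltr_pdivrMr ?expR_gt0// mul1r expR_gt1Dx//.
  by rewrite gt_eqF.
nra.
Qed.

(** The first part integrates [chord_levy_kernel_gt0]. In case of equality a strictly positive
    function has integral 0, so [m] gives no mass to [D] and every kernel integral vanishes. *)
Lemma chord_Rintegral_levy_kernel (p y : R) : 0 < p -> p < y ->
  y * (\int[m]_(u in D) levy_kernel p u) <= p * (\int[m]_(u in D) levy_kernel y u) /\
  (p * (\int[m]_(u in D) levy_kernel y u) <= y * (\int[m]_(u in D) levy_kernel p u) ->
     forall z : R, 0 <= z -> \int[m]_(u in D) levy_kernel z u = 0).
Proof.
move=> p0 py; have y0 := lt_trans p0 py.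
have mD : measurable D by exact: measurable_itv.
have ip := integrable_levy_kernel (ltW p0); have iy := integrable_levy_kernel (ltW y0).
have ipy : m.-integrable D
    (EFin \o (fun u => p * levy_kernel y u - y * levy_kernel p u)).
  rewrite (_ : _ \o _ = (fun u =>
    p%:E * (levy_kernel y u)%:E - y%:E * (levy_kernel p u)%:E)%E)//.
  exact: (integrableB mD (integrableZl mD p iy) (integrableZl mD y ip)).
have E : p * (\int[m]_(u in D) levy_kernel y u) -
    y * (\int[m]_(u in D) levy_kernel p u) =
    \int[m]_(u in D) (p * levy_kernel y u - y * levy_kernel p u).
  rewrite (RintegralB mD (integrableZl mD p iy) (integrableZl mD y ip)).
  by rewrite !RintegralZl.
have gt0 u : D u -> 0 < p * levy_kernel y u - y * levy_kernel p u.
  by rewrite /= in_itv/= andbT => u0; exact: chord_levy_kernel_gt0.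
split=> [|le z z0].
  by rewrite -subr_ge0 E; apply: Rintegral_ge0 => u /gt0 /ltW.
have mi : measurable_fun D (fun u => (p * levy_kernel y u - y * levy_kernel p u)%:E).
  exact: measurable_int ipy.
have I0 : (\int[m]_(u in D) `|(p * levy_kernel y u - y * levy_kernel p u)%:E| = 0)%E.
  transitivity (\int[m]_(u in D) (p * levy_kernel y u - y * levy_kernel p u)%:E)%E.
    by apply: eq_integral => u; rewrite inE => /gt0 /ltW h; rewrite gee0_abs.
  rewrite -[LHS]fineK; last exact: integrable_fin_num ipy.
  congr EFin; apply/le_anti/andP; split; first by rewrite -[leLHS]E subr_le0.
  by apply: fine_ge0; apply: integral_ge0 => u /gt0 /ltW; rewrite lee_fin.
(* The integrand vanishes almost everywhere but nowhere on [D], so [D] is contained in a null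
   set. *)
have mD0 : m D = 0%E.
  have /(ae_eq_integral_abs _ mD mi)[N [mN N0 DN]] := I0.
  apply: (subset_measure0 mD mN _ N0) => u Du; apply: DN => /= /(_ Du) /eqP.
  by rewrite eqe gt_eqF// gt0.
rewrite /Rintegral null_set_integral//.
exact: measurable_int (integrable_levy_kernel z0).
Qed.

End levy_integral.

(** * Convexity, derivative and growth of a branching mechanism *)

Section branching_mechanism.
Context {R : realType} (phi : R -> R).
Hypothesis hphi : is_branching_mechanism phi.

Lemma branching0 : phi 0 = 0.
Proof.
have [b [c [m [_ _ _ ->//]]]] := hphi.
rewrite mulr0 expr0n/= mulr0 !add0r.
under eq_Rintegral do rewrite mul0r oppr0 expR0 subrr addr0.
by rewrite Rintegral_cst// mul0r.
Qed.

(** Monotonicity of [phi z / z], without division: the linear terms cancel, the quadratic ones leave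
    [c * (p * y * (y - p))], and the integrals are compared by the chord inequality. *)
Lemma branching_star (p y : R) : 0 < p -> p < y -> y * phi p <= p * phi y.
Proof.
have [b [c [m [c0 _ hm e]]]] := hphi => p0 py.
have y0 := lt_trans p0 py; rewrite (e p (ltW p0)) (e y (ltW y0)).
have [+ _] := chord_Rintegral_levy_kernel hm p0 py; rewrite /levy_kernel.
have : 0 <= c * (p * y * (y - p)).
  by rewrite mulr_ge0// !mulr_ge0// ?ltW// subr_gt0.
nra.
Qed.

(* A convex function may vanish on an interval before becoming positive, and
   [phi_inv] would then jump at 0; a branching mechanism cannot, because equality
   in [branching_star] forces [c = 0] and [m = 0] on (0, oo). *)
Lemma branching_rigid (p y : R) : 0 < p -> p < y -> 0 <= phi p -> phi y <= 0 ->
  forall z : R, 0 <= z -> phi z = 0.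
Proof.
have [b [c [m [c0 _ hm e]]]] := hphi => p0 py pp py0.
have y0 := lt_trans p0 py.
have [le1 rigid] := chord_Rintegral_levy_kernel hm p0 py.
rewrite /levy_kernel in le1 rigid.
have q0 : 0 < p * y * (y - p) by rewrite !mulr_gt0// subr_gt0.
have cq : 0 <= c * (p * y * (y - p)) by rewrite mulr_ge0// ltW.
have yp : y * phi p = 0 /\ p * phi y = 0.
  have := branching_star p0 py; have : 0 <= y * phi p by rewrite mulr_ge0// ltW.
  have : p * phi y <= 0 by rewrite pmulr_rle0.
  by split; lra.
have [yp1 pp1] := yp; rewrite (e p (ltW p0)) (e y (ltW y0)) in yp1 pp1.
(* The quadratic and the integral contributions to [p * phi y - y * phi p] are both nonnegative and
   add up to 0. *)
have cq0 : c * (p * y * (y - p)) = 0 by nra.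
have c00 : c = 0.
  by apply/eqP; move/eqP: cq0; rewrite mulf_eq0 (gt_eqF q0) orbF.
have I0 : forall z : R, 0 <= z ->
    \int[m]_(u in `]0, +oo[) (expR (- (z * u)) - 1 + z * u) = 0.
  by apply: rigid; nra.
have b0 : b = 0.
  move: yp1; rewrite c00 (I0 p (ltW p0)) mul0r !addr0 => /eqP.
  by rewrite !mulf_eq0 (gt_eqF p0) (gt_eqF y0) orbF => /eqP.
by move=> z z0; rewrite e// b0 c00 I0// !mul0r !addr0.
Qed.

Lemma branching_derivative : exists2 dphi : R -> R,
  forall z : R, 0 < z -> is_derive z (1 : R) phi (dphi z) &
  forall x y : R, 0 < x -> x <= y -> dphi x <= dphi y.
Proof.
have [b [c [m [c0 _ hm e]]]] := hphi.
exists (fun z => b + 2 * c * z +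
    \int[m]_(u in `]0, +oo[) (u * (1 - expR (- (z * u))))) => [z z0|x y x0 xy].
  pose psi := (fun z => b * z + c * z ^+ 2) \+
    (fun z => \int[m]_(u in `]0, +oo[) levy_kernel z u).
  have dpsi : is_derive z (1 : R) psi (b + 2 * c * z +
      \int[m]_(u in `]0, +oo[) (u * (1 - expR (- (z * u))))).
    have := is_derive_Rintegral_levy_kernel hm z0 => h.
    apply: is_deriveD.
    apply: is_derive_eq.
    by rewrite /GRing.scale/= !mulr1; ring.
  (* The formula for [phi] is available only at nonnegative arguments, hence only in a neighbourhood
     of [z > 0]. *)
  apply: near_eq_is_derive dpsi.
  near=> w; rewrite e//; apply/ltW; near: w.
  exact: lt_nbhsr.
have := nondecreasing_Rintegral_deriv_levy_kernel hm x0 xy.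
have : c * x <= c * y by rewrite ler_wpM2l.
lra.
Unshelve. all: by end_near. Qed.

Lemma branching_continuous (z : R) : 0 < z -> {for z, continuous phi}.
Proof.
move=> z0; have [dphi dphiE _] := branching_derivative.
have [/derivable1_diffP h _] := dphiE _ z0.
exact: differentiable_continuous.
Qed.

(** The derivative is nondecreasing, so its limit at infinity is its supremum; the sign of the slope
    at infinity thus becomes a statement about individual values of [dphi]. *)
Lemma dphi_inftyE : exists2 dphi : R -> R,
  [/\ forall z : R, 0 < z -> is_derive z (1 : R) phi (dphi z) &
  forall x y : R, 0 < x -> x <= y -> dphi x <= dphi y] &
  dphi_infty phi = ereal_sup [set (dphi z)%:E | z in `]0, +oo[].
Proof.
have [dphi dphiE nd] := branching_derivative; exists dphi => //.
(* Extension by the value [-oo] makes the derivative monotone on the whole line and leaves its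
   supremum unchanged. *)
pose g z : \bar R := if 0 < z then (dphi z)%:E else -oo%E.
have ndg : {homo g : x y / x <= y >-> (x <= y)%E}.
  move=> x y xy; rewrite /g; case: ifPn => [x0|_]; last exact: leNye.
  by rewrite (lt_le_trans x0 xy) lee_fin nd.
have gE : (derive1 phi z)%:E @[z --> +oo%R] --> ereal_sup (range g).
  apply: cvg_trans (nondecreasing_cvge ndg); apply: near_eq_cvg.
  near=> z.
  have z0 : 0 < z by near: z; exact: nbhs_pinfty_gt.
  by rewrite /g z0 derive1E; have /@derive_val -> := dphiE _ z0.
rewrite /dphi_infty (cvg_lim _ gE)//.
apply/le_anti/andP; split; apply: ub_ereal_sup => _ [z /= z0 <-].
  rewrite /g; case: ifPn => [{}z0|_]; last exact: leNye.
  by apply: ereal_sup_ubound; exists z => //=; rewrite in_itv/= z0.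
apply: ereal_sup_ubound; exists z => //; rewrite /g.
by move: z0; rewrite in_itv/= andbT => ->.
Unshelve. all: by end_near. Qed.

Lemma branching_MVT (dphi : R -> R) (x y : R) :
  (forall z : R, 0 < z -> is_derive z (1 : R) phi (dphi z)) -> 0 < x -> x < y ->
  exists2 z, x < z & phi y - phi x = dphi z * (y - x).
Proof.
move=> dphiE x0 xy.
have [||c] := @MVT _ phi dphi _ _ xy.
- by move=> z; rewrite in_itv/= => /andP[xz _]; apply: dphiE; exact: lt_trans xz.
- apply: continuous_in_subspaceT => z; rewrite inE/= in_itv/= => /andP[xz _].
  by apply: branching_continuous; exact: lt_le_trans xz.
- by rewrite in_itv/= => /andP[xz _]; exists c.
Qed.

(** Some [dphi w] is positive and bounds all later slopes from below, so [phi] grows at least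
    linearly after [w]. *)
Lemma branching_unbounded : (0 < dphi_infty phi)%E ->
  forall K : R, exists2 z, 0 < z & K < phi z.
Proof.
have [dphi [dphiE nd] ->] := dphi_inftyE.
move=> /ereal_sup_gt [_ [w + <-]]; rewrite /= in_itv/= andbT lte_fin => w0 d0 K.
(* Chosen so that a slope of at least [dphi w] raises [phi] by at least [1 + |K - phi w|] between
   [w] and [z]. *)
pose z := w + (1 + `|K - phi w|) / dphi w.
have wz : w < z by rewrite ltrDl divr_gt0// ltr_pwDl.
exists z; first exact: lt_trans wz.
have [x wx] := branching_MVT dphiE w0 wz.
have dx := nd _ _ w0 (ltW wx).
have : dphi w * (z - w) <= dphi x * (z - w) by rewrite ler_wpM2r// subr_ge0 ltW.
have -> : dphi w * (z - w) = 1 + `|K - phi w|.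
  by rewrite /z addrAC subrr add0r mulrC divfK// gt_eqF.
have := ler_norm (K - phi w).
lra.
Qed.

(** All slopes are nonpositive, so [phi (2 * z) <= phi z]; together with [2 * phi z <= phi (2 * z)]
    from [branching_star] this gives the sign. *)
Lemma branching_nonpos : (dphi_infty phi <= 0)%E ->
  forall z : R, 0 < z -> phi z <= 0.
Proof.
have [dphi [dphiE nd] ->] := dphi_inftyE => le0 z z0.
have d0 (w : R) : 0 < w -> dphi w <= 0.
  move=> w0; rewrite -lee_fin; apply: le_trans le0.
  by apply: ereal_sup_ubound; exists w => //=; rewrite in_itv/= w0.
have z2 : z < 2 * z by lra.
have [x zx] := branching_MVT dphiE z0 z2.
have dx := d0 _ (lt_trans z0 zx).
have := branching_star z0 z2.
nra.
Qed.

(** * The inverse of [phi] when the slope at infinity is positive *)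

Section supercritical_slope.
Hypothesis slope_gt0 : (0 < dphi_infty phi)%E.

Let phi_inv_set_nonempty (theta : R) : [set z | 0 <= z /\ theta < phi z] !=set0.
Proof. by have [z /ltW z0 tz] := branching_unbounded slope_gt0 theta; exists z. Qed.

Let phi_inv_lbound (theta : R) : has_lbound [set z | 0 <= z /\ theta < phi z].
Proof. by exists 0 => z []. Qed.

Lemma phi_inv_le (theta z : R) : 0 < theta -> 0 <= z -> theta < phi z ->
  phi_inv phi theta <= z.
Proof.
by move=> t0 z0 tz; rewrite /phi_inv gt_eqF//; apply: ge_inf.
Qed.

(** Below a point [z] with [phi z > theta], [branching_star] gives [phi w <= w * phi z / z]. Hence
    every [w] with [phi w > theta] is at least [theta * z / phi z]. *)
Lemma phi_inv_gt0 (theta : R) : 0 < theta -> 0 < phi_inv phi theta.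
Proof.
move=> t0; rewrite /phi_inv gt_eqF//.
have [z z0 tz] := branching_unbounded slope_gt0 theta.
have pz0 := lt_trans t0 tz.
apply: (@lt_le_trans _ _ (theta * z / phi z)).
  by rewrite divr_gt0// mulr_gt0.
apply: lb_le_inf => // w [w0 tw]; rewrite ler_pdivrMr//.
have {}w0 : 0 < w.
  rewrite lt_neqAle w0 andbT eq_sym; apply/eqP => w00.
  by move: tw; rewrite w00 branching0 ltNge ltW.
have [wz|zw] := ltP w z; last first.
  by rewrite mulrC; apply: ler_pM => //; exact: ltW.
apply: le_trans (branching_star w0 wz).
by rewrite mulrC ler_wpM2l ?(ltW z0)// ltW.
Qed.

(** Continuity at the infimum excludes both strict inequalities: a larger value would put a smaller
    point in the set, a smaller value would keep the set away from its infimum. *)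
Lemma phi_invK (theta : R) : 0 < theta -> phi (phi_inv phi theta) = theta.
Proof.
move=> t0; have q0 := phi_inv_gt0 t0; have cq := branching_continuous q0.
apply/eqP; rewrite eq_le; apply/andP; split; rewrite leNgt; apply/negP => h.
  have : \forall w \near phi_inv phi theta, 0 < w /\ theta < phi w.
    near=> w; split; near: w; first exact: lt_nbhsr.
    exact: (cq _ (lt_nbhsr h)).
  move=> /nbhs_ballP[e /= e0]/(_ (phi_inv phi theta - e / 2)).
  case.
    by rewrite /ball/= opprB addrC subrK gtr0_norm; lra.
  move=> /ltW w0 tw.
  by have := phi_inv_le t0 w0 tw; lra.
have : \forall w \near phi_inv phi theta, phi w < theta.
  exact: (cq _ (lt_nbhsl h)).
move=> /nbhs_ballP[e /= e0] he.
have hinf : has_inf [set z | 0 <= z /\ theta < phi z] by split.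
have [w [w0 tw]] := inf_adherent e0 hinf.
have qw := phi_inv_le t0 w0 tw.
have : phi_inv phi theta = inf [set z | 0 <= z /\ theta < phi z].
  by rewrite /phi_inv gt_eqF.
move=> <- we.
have := he w; rewrite /ball/= distrC ger0_norm ?subr_ge0// ltrBlDl => /(_ we).
by rewrite ltNge (ltW tw).
Unshelve. all: by end_near. Qed.

Let phi_inv0E : phi_inv phi 0 = inf [set z | 0 < z /\ 0 <= phi z].
Proof. by rewrite /phi_inv eqxx. Qed.

(** Right continuity of the inverse at 0, although the two cases of [phi_inv] use different sets. By
    rigidity [phi] is already positive at [phi_inv phi 0 + e], and that value serves as [eta]. *)
Lemma phi_inv_cvg0 (e : R) : 0 < e -> exists2 eta : R, 0 < eta &
  forall theta, 0 < theta -> theta < eta ->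
    phi_inv phi 0 <= phi_inv phi theta <= phi_inv phi 0 + e.
Proof.
move=> e0.
have hinf : has_inf [set z | 0 < z /\ 0 <= phi z].
  split; last by exists 0 => z [/ltW].
  by have [z z0 /ltW pz] := branching_unbounded slope_gt0 0; exists z.
have [w [w0 pw] we] := inf_adherent e0 hinf.
rewrite -phi_inv0E in we.
have py : 0 < phi (phi_inv phi 0 + e).
  rewrite ltNge; apply/negP => py.
  have [z z0] := branching_unbounded slope_gt0 0.
  by rewrite (branching_rigid w0 we pw py (ltW z0)) ltxx.
exists (phi (phi_inv phi 0 + e)) => // theta t0 te; apply/andP; split.
  rewrite phi_inv0E; apply: ge_inf; first by case: hinf.
  by split; [exact: phi_inv_gt0|rewrite phi_invK// ltW].
by apply: phi_inv_le => //; apply: ltW; exact: lt_trans we.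
Qed.

End supercritical_slope.
End branching_mechanism.

(** * The discrete martingale *)

Section positive_functional.
Local Open Scope ereal_scope.
Import finmap HBNNSimple.
Context d (T : measurableType d) (R : realType).
Implicit Types (Phi Psi : (T -> \bar R) -> \bar R) (f g : T -> \bar R).

(** The properties of an integral used in approximation by simple functions. Abstracting them treats
    alike two sides of an identity that integrate in different ways. *)
Record is_positive_functional Phi : Prop := {
  functional0 : Phi (cst 0) = 0 ;
  functional_linear : forall (c : R) f g, (0 <= c)%R ->
    measurable_fun setT f -> (forall x, 0 <= f x) ->
    measurable_fun setT g -> (forall x, 0 <= g x) ->
    Phi (fun x => c%:E * f x + g x) = c%:E * Phi f + Phi g ;
  functional_monotone : forall (f : nat -> T -> \bar R),
    (forall n, measurable_fun setT (f n)) -> (forall n x, 0 <= f n x) ->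
    (forall x, nondecreasing_seq (f^~ x)) ->
    Phi (fun x => limn (f^~ x)) = limn (fun n => Phi (f n)) }.

Lemma positive_functional_ext Phi Psi :
  is_positive_functional Phi -> is_positive_functional Psi ->
  (forall A, measurable A -> Phi (EFin \o \1_A) = Psi (EFin \o \1_A)) ->
  forall f, measurable_fun setT f -> (forall x, 0 <= f x) -> Phi f = Psi f.
Proof.
move=> [Phi0 PhiL PhiM] [Psi0 PsiL PsiM] eqA f mf f0.
pose h := nnsfun_approx measurableT mf.
have mh n : measurable_fun setT (EFin \o h n).
  by apply/measurable_EFinP; exact: measurable_funP.
have h0 n x : 0 <= (EFin \o h n) x by rewrite /= lee_fin fun_ge0.
have ndh x : nondecreasing_seq (fun n => (EFin \o h n) x).
  by move=> a b ab; rewrite /= lee_fin; exact/lefP/nd_nnsfun_approx.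
have fE : f = (fun x => limn (fun n => (EFin \o h n) x)).
  by apply/funext => x; apply/esym/cvg_lim => //; exact: cvg_nnsfun_approx.
rewrite fE PhiM// PsiM//; congr (limn _); apply/funext => n.
have -> : EFin \o h n = (fun x => \sum_(r <- (fset_set (range (h n))))
    (r * \1_(h n @^-1` [set r]) x)%:E).
  apply/funext => x /=; rewrite fimfunE fsbig_finite//= sumEFin//.
have : {in finmap.enum_fset (fset_set (range (h n))), forall r : R, (0 <= r)%R}.
  move=> r rs; have : r \in fset_set (range (h n)) by [].
  by rewrite in_fset_set// => /set_mem[x _ <-]; exact: fun_ge0.
(* Induction on the list of values only; the preimages under [h n] stay fixed. *)
elim: (finmap.enum_fset _) => [_|r s ih hs].
  have -> : (fun x => \sum_(r <- [::]) (r * \1_(h n @^-1` [set r]) x)%:E) = cst 0.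
    by apply/funext => x; rewrite big_nil.
  by rewrite Phi0 Psi0.
have r0 : (0 <= r)%R by apply: hs; rewrite mem_head.
have hs' : {in s, forall r : R, (0 <= r)%R}.
  by move=> q qs; apply: hs; rewrite inE qs orbT.
have -> : (fun x => \sum_(r <- r :: s) (r * \1_(h n @^-1` [set r]) x)%:E) =
    (fun x => r%:E * (EFin \o \1_(h n @^-1` [set r])) x +
      \sum_(r <- s) (r * \1_(h n @^-1` [set r]) x)%:E).
  by apply/funext => x; rewrite big_cons.
have mr q : measurable (h n @^-1` [set q]) by exact: measurable_sfunP.
have mi q : measurable_fun setT (EFin \o \1_(h n @^-1` [set q]) : T -> \bar R).
  exact/measurable_EFinP/measurable_indic.
have ms : measurable_fun setT
    (fun x => \sum_(r <- s) (r * \1_(h n @^-1` [set r]) x)%:E).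
  apply: emeasurable_sum => q; apply/measurable_EFinP.
  by apply: measurable_funM => //; exact: measurable_indic.
have s0 x : 0 <= \sum_(r <- s) (r * \1_(h n @^-1` [set r]) x)%:E.
  rewrite big_seq; apply: sume_ge0 => q /hs' q0.
  by rewrite lee_fin mulr_ge0.
have i0 x : 0 <= (EFin \o (\1_(h n @^-1` [set r]) : T -> R)) x by rewrite /= lee_fin.
rewrite (PhiL r _ _ r0 (mi r) i0 ms s0) (PsiL r _ _ r0 (mi r) i0 ms s0).
by rewrite eqA// ih.
Qed.

End positive_functional.

Section integral_functionals.
Local Open Scope ereal_scope.
Context d (S : measurableType d) d' (T : measurableType d') (R : realType).
Context (mu : {measure set S -> \bar R}) (D : set S) (mD : measurable D).

(** With [g = 1] this is integration against the law of [Y]; an exponential [g] is the weight in the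
    Laplace form of the Markov property. *)
Lemma functional_density (Y : S -> T) (g : S -> R) :
  measurable_fun setT Y -> measurable_fun setT g -> (forall w, (0 <= g w)%R) ->
  is_positive_functional (fun f => \int[mu]_(w in D) ((g w)%:E * f (Y w))).
Proof.
move=> mY mg g0'; have g0 w : 0 <= (g w)%:E by rewrite lee_fin.
have mgf f : measurable_fun setT f -> measurable_fun D (fun w => (g w)%:E * f (Y w)).
  move=> mf; apply: (measurable_funS measurableT) => //.
  apply: emeasurable_funM; first exact/measurable_EFinP.
  exact: measurableT_comp mf mY.
split.
- by under eq_integral do rewrite mule0; rewrite integral0.
- move=> c f h c0 mf f0 mh h0.
  rewrite -ge0_integralZl_EFin//; [|by move=> w _; rewrite mule_ge0|exact: mgf].
  rewrite -ge0_integralD//.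
  + apply: eq_integral => w _; rewrite ge0_muleDr// ?mule_ge0 ?lee_fin//.
    by rewrite muleCA.
  + by move=> w _; rewrite !mule_ge0// lee_fin.
  + by apply: measurable_funeM; exact: mgf.
  + by move=> w _; rewrite mule_ge0.
  + exact: mgf.
- move=> f mf f0 ndf; rewrite -monotone_convergence//.
  + apply: eq_integral => w _.
    rewrite limeMl//; apply: ereal_nondecreasing_is_cvgn => a b ab.
    exact: ndf.
  + by move=> n; exact: mgf.
  + by move=> n w _; rewrite mule_ge0.
  + by move=> w _ a b ab; rewrite lee_wpmul2l//; exact: ndf.
Qed.

Lemma functional_kernel (K : S -> {measure set T -> \bar R}) :
  (forall U, measurable U -> measurable_fun setT (K ^~ U)) ->
  is_positive_functional (fun f => \int[mu]_(w in D) \int[K w]_y f y).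
Proof.
move=> mK.
have mi f : measurable_fun setT f -> (forall y, 0 <= f y) ->
    measurable_fun D (fun w => \int[K w]_y f y).
  move=> mf f0; apply: (measurable_funS measurableT) => //.
  exact: measurable_fun_integral_kernel.
split.
- by under eq_integral do rewrite integral0; rewrite integral0.
- move=> c f h c0 mf f0 mh h0.
  rewrite -ge0_integralZl_EFin//;
    [|by move=> w _; exact: integral_ge0|exact: mi].
  rewrite -ge0_integralD//.
  + apply: eq_integral => w _; rewrite ge0_integralD//.
    * by rewrite ge0_integralZl_EFin.
    * by move=> y _; rewrite mule_ge0.
    * exact: measurable_funeM.
  + by move=> w _; rewrite mule_ge0//; exact: integral_ge0.
  + by apply: measurable_funeM; exact: mi.
  + by move=> w _; exact: integral_ge0.
  + exact: mi.
- move=> f mf f0 ndf; rewrite -monotone_convergence//.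
  + by apply: eq_integral => w _; rewrite monotone_convergence.
  + by move=> n; exact: mi.
  + by move=> n w _; exact: integral_ge0.
  + move=> w _ a b ab; apply: ge0_le_integral => // y _; exact: ndf.
Qed.

End integral_functionals.

(** A filtration is given by bare sets of sets. Turning [G] into the measurable structure of a type
    makes the closure properties of measurable functions apply to it. *)
Lemma sub_sigma_algebra_comp_sum (R : realType) (T : Type) (G : set (set T))
    (I : Type) (r : seq I) (f : I -> T -> R) (g : R -> R) (B : set R) :
  sigma_algebra setT G ->
  (forall i B, measurable B -> G (f i @^-1` B)) ->
  measurable_fun setT g -> measurable B ->
  G ((fun w => g (\sum_(i <- r) f i w)) @^-1` B).
Proof.
move=> sG fG mg mB.
have [[w0 _]|T0] := pselect (exists w : T, True); last first.
  rewrite (_ : _ @^-1` _ = set0); first by case: sG.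
  by apply/seteqP; split=> // w _; apply: T0; exists w.
(* [g_sigma_algebraType] expects a pointed type. *)
pose pT : pointedType :=
  HB.pack T (gen_eqMixin T) (gen_choiceMixin T) (isPointed.Build T w0).
have mG (A : set (g_sigma_algebraType (G : set (set pT)))) : measurable A = G A.
  by rewrite [measurable](@measurable_g_measurableTypeE pT G sG).
have mf i : measurable_fun setT (f i : g_sigma_algebraType (G : set (set pT)) -> R).
  by move=> _ C mC; rewrite setTI mG; exact: fG.
have mgf : measurable_fun setT
    ((fun w => g (\sum_(i <- r) f i w)) : g_sigma_algebraType (G : set (set pT)) -> R).
  apply: (measurableT_comp mg); exact: measurable_sum.
by rewrite -mG -[X in measurable X]setTI; exact: mgf.
Qed.

(** * From the Markov property to the exponential martingale *)

Section discrete_martingale.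
Context (R : realType) (phi : R -> R) (P : R -> R.-pker R ~> R).
Context (d : measure_display) (Omega : measurableType d).
Context (F : R -> set (set Omega)) (X : R -> Omega -> R).
Context (Q : R -> probability Omega R).
Hypothesis hX : is_markov_realization P F X Q.

Lemma markov_measurable (t : R) : 0 <= t -> measurable_fun setT (X t).
Proof.
move=> t0 _ B mB; rewrite setTI; have [_ Fm _] := markov_filtration hX.
exact: (Fm _ t0 _ (markov_adapted hX t0 mB)).
Qed.

Lemma markov_property_fun (x s t : R) (A : set Omega) (f : R -> \bar R) :
  0 <= x -> 0 <= s -> 0 <= t -> F s A -> measurable_fun setT f ->
  (forall y, (0 <= f y)%E) ->
  (\int[Q x]_(w in A) f (X (s + t) w) =
   \int[Q x]_(w in A) \int[P t (X s w)]_y f y)%E.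
Proof.
move=> x0 s0 t0 FA mf f0; have st0 : 0 <= s + t by rewrite addr_ge0.
have mA : measurable A.
  by have [_ Fm _] := markov_filtration hX; exact: Fm FA.
(* The factor 1 brings the left-hand side into the form of [functional_density]. *)
under eq_integral do rewrite -[f _]mul1e.
apply: (positive_functional_ext _ _ _ mf f0
  (Phi := fun f => (\int[Q x]_(w in A) ((1%R)%:E * f (X (s + t) w)))%E)
  (Psi := fun f => (\int[Q x]_(w in A) \int[P t (X s w)]_y f y)%E)).
- apply: (functional_density _ mA (g := cst 1)) => //.
  exact: markov_measurable.
- apply: functional_kernel => // U mU.
  exact: measurableT_comp (measurable_kernel (P t) U mU) (markov_measurable s0).
- move=> B mB /=.
  under eq_integral do rewrite mul1e.
  under [RHS]eq_integral do rewrite integral_indic// setIT.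
  rewrite -(markov_property hX)// setIC -integral_indic//.
  by rewrite -[X in measurable X]setTI; exact: markov_measurable.
Qed.

Variable v : R -> R -> R.
Hypothesis hv : forall lambda : R, 0 <= lambda -> forall t x : R, 0 <= t -> 0 <= x ->
  (\int[P t x]_(y in `[0%R, +oo[) (expR (- (lambda * y)))%:E
     = (expR (- (x * v t lambda)))%:E)%E.

Lemma markov_laplace (x s t lambda : R) (Y : Omega -> R) :
  0 <= x -> 0 <= s -> 0 <= t -> 0 <= lambda ->
  (forall B, measurable B -> F s (Y @^-1` B)) -> (forall w, 0 <= Y w) ->
  (\int[Q x]_w (expR (- (lambda * X (s + t) w)) * Y w)%:E =
   \int[Q x]_w (expR (- (X s w * v t lambda)) * Y w)%:E)%E.
Proof.
move=> x0 s0 t0 l0 FY Y0; have st0 : 0 <= s + t by rewrite addr_ge0.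
have mexp (c : R) : measurable_fun setT (fun y : R => expR (- (c * y))).
  apply: measurableT_comp; first exact: measurable_expR.
  by apply: measurableT_comp => //; exact: measurable_funM.
have mY : measurable_fun setT Y.
  move=> _ B mB; rewrite setTI; have [_ Fm _] := markov_filtration hX.
  exact: Fm (FY _ mB).
pose D : set R := `[0, +oo[%classic.
(* The Laplace formula of the semigroup integrates over [D] only; the cut-off changes nothing along
   the paths, which are nonnegative. *)
pose f : R -> \bar R := (fun y => (expR (- (lambda * y)))%:E) \_ D.
have mD : measurable D by exact: measurable_itv.
have mf : measurable_fun setT f.
  rewrite /f; apply/(measurable_restrictT _ mD); apply/measurable_EFinP.
  exact: (measurable_funS measurableT).
have f0 y : (0 <= f y)%E.
  by apply: erestrict_ge0 => z _; rewrite lee_fin expR_ge0.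
have E : forall f, measurable_fun setT f -> (forall y, 0 <= f y)%E ->
   (\int[Q x]_w ((expR (- (lambda * X (s + t) w)))%:E * f (Y w)) =
   \int[Q x]_w ((expR (- (X s w * v t lambda)))%:E * f (Y w)))%E.
  apply: positive_functional_ext.
  - apply: functional_density => //.
    exact: measurableT_comp (mexp lambda) (markov_measurable st0).
  - apply: functional_density => //.
    under eq_fun do rewrite mulrC.
    exact: measurableT_comp (mexp (v t lambda)) (markov_measurable s0).
  - move=> B mB /=.
    have mYB : measurable (Y @^-1` B) by rewrite -[X in measurable X]setTI; exact: mY.
    have E1 (g : Omega -> R) :
        (\int[Q x]_w ((g w)%:E * (\1_B (Y w))%:E) =
         \int[Q x]_(w in Y @^-1` B) (g w)%:E)%E.
      rewrite [RHS]integral_mkcond; apply: eq_integral => w _.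
      by rewrite epatch_indic.
    have fX (r : R) w : 0 <= r -> f (X r w) = (expR (- (lambda * X r w)))%:E.
      move=> r0; rewrite /f patchE mem_set// /D /= in_itv/= andbT.
      exact: markov_state hX _ _ r0.
    rewrite !E1.
    under eq_integral do rewrite -fX//.
    rewrite markov_property_fun//; last exact: FY.
    apply: eq_integral => w _; rewrite -integral_mkcond hv//.
    exact: markov_state hX _ _ s0.
(* The absolute value is nonnegative everywhere and is the identity on the values of [Y]. *)
have := E (fun y => `|y|%:E); rewrite /= => {}E.
under eq_integral do rewrite EFinM -[Y _]ger0_norm//.
under [RHS]eq_integral do rewrite EFinM -[Y _]ger0_norm//.
apply: E => [|y]; last by rewrite lee_fin.
by apply/measurable_EFinP; exact: normr_measurable.
Qed.

(** One step back in time turns [z * X ((n + 1) h)] into [v h z * X (n h)], and the last summand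
    [(z - v h z) * X (n h)] restores the coefficient [z]. *)
Lemma discrete_martingale (x h z : R) (n : nat) : 0 <= x -> 0 <= h -> 0 <= z ->
  (\int[Q x]_w (expR (- (z * X (n%:R * h) w +
      (z - v h z) * \sum_(j < n) X (j%:R * h) w)))%:E = (expR (- (x * z)))%:E)%E.
Proof.
move=> x0 h0 z0; elim: n => [|n ih].
  under eq_integral do rewrite big_ord0 mulr0 addr0 mul0r.
  have m0 : measurable [set w | X 0 w = x].
    have := markov_measurable (lexx 0) measurableT (measurable_set1 x).
    by rewrite setTI.
  have Q0 := markov_start hX x0.
  transitivity (\int[Q x]_w (cst (expR (- (x * z)))%:E w))%E; last first.
    by rewrite integral_cst//= probability_setT mule1.
  apply: ae_eq_integral => //.
  - apply/measurable_EFinP; apply: measurableT_comp; first exact: measurable_expR.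
    apply: measurableT_comp => //; apply: measurable_funM => //.
    exact: markov_measurable.
  - exists (~` [set w | X 0 w = x]); split.
    + exact: measurableC.
    + have := probability_setC (Q x) m0; rewrite Q0 subee// => ->.
    + by move=> w /=; apply: contra_not => -> _; rewrite mulrC.
have n0 : 0 <= n%:R * h by rewrite mulr_ge0.
rewrite -[RHS]ih.
pose Y w := expR (- ((z - v h z) * \sum_(j < n.+1) X (j%:R * h) w)).
transitivity (\int[Q x]_w (expR (- (z * X (n%:R * h + h) w)) * Y w)%:E)%E.
  have -> : n.+1%:R * h = n%:R * h + h by rewrite -natr1 mulrDl mul1r.
  by apply: eq_integral => w _; rewrite /Y opprD expRD.
rewrite markov_laplace//.
- apply: eq_integral => w _; congr EFin; rewrite /Y big_ord_recr/= -expRD.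
  by congr expR; ring.
- move=> B mB.
  apply: (@sub_sigma_algebra_comp_sum _ _ (F (n%:R * h)) _ _
    (fun j : 'I_n.+1 => X (j%:R * h)) (fun y => expR (- ((z - v h z) * y)))) => //.
  + have [Fs _ _] := markov_filtration hX; exact: Fs.
  + move=> i C mC; have [_ _ Fi] := markov_filtration hX.
    have i0 : 0 <= i%:R * h by rewrite mulr_ge0.
    apply: (Fi _ _ i0 _ _ (markov_adapted hX i0 mC)).
    by rewrite ler_wpM2r// ler_nat -ltnS.
  + apply: measurableT_comp; first exact: measurable_expR.
    by apply: measurableT_comp => //; exact: measurable_funM.
- by move=> w; exact: expR_ge0.
Qed.

End discrete_martingale.

(** * Riemann sums of cadlag paths *)

Section riemann_sums.
Context {R : realType} (f : R -> R).
Hypothesis cf : cadlag f.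
Hypothesis f0 : forall t : R, 0 <= t -> 0 <= f t.
Local Notation mu := (@lebesgue_measure R).

(** Compactness of the segment: near each [t] the path stays within 1 of [f t] on the right and of
    its left limit on the left. *)
Lemma cadlag_bounded (N : R) : exists M : R,
  forall t, 0 <= t -> t <= N -> `|f t| <= M.
Proof.
have /compact_near_coveringP/near_covering_withinP/(_ R +oo%R
  (fun M t => `|f t| <= M)) := @segment_compact R 0 N.
case=> [t|M [_ HM]]; last first.
- exists (M + 1) => t t0 tN; apply: (HM (M + 1)); first by rewrite ltrDl.
  by rewrite /= in_itv/= t0.
- rewrite /= in_itv/= => /andP[t0 _].
  have /cvgrPdist_lt/(_ _ ltr01) := cf.1 t t0.
  rewrite near_withinE => hr.
  have [l hl] : exists l : R, \forall s \near t, 0 <= s -> s < t -> `|l - f s| < 1.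
    move: t0; rewrite le_eqVlt => /predU1P[<-|t0].
      (* At [t = 0] no admissible [s] lies to the left, so any value serves as left limit. *)
      by exists 0; near=> s => s0; rewrite ltNge s0.
    have [l /cvgrPdist_lt/(_ _ ltr01)] := cf.2 t t0.
    rewrite near_withinE => hl; exists l.
    by apply: filterS hl => s + _; exact.
  near=> s M; rewrite /= in_itv/= => /andP[s0 _].
  have M1 : `|f t| + `|l| + 1 <= M.
    by near: M; exact: nbhs_pinfty_ge.
  have := normr_ge0 (f t); have := normr_ge0 l => l0 ft0.
  have [st|ts|->] := ltgtP s t; last by lra.
  + have : `|l - f s| < 1 by move: st; move: s0; near: s; exact: hl.
    have := ler_normB l (l - f s); rewrite opprB addrC subrK; lra.
  + have : `|f t - f s| < 1 by move: ts; near: s; exact: hr.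
    have := ler_normB (f t) (f t - f s); rewrite opprB addrC subrK; lra.
Unshelve. all: by end_near. Qed.

(* Right endpoints, so that pointwise convergence only uses right continuity. *)
Let step (n N : nat) (s : R) : R :=
  \sum_(k < N * n.+1) f (k.+1%:R / n.+1%:R) *
     \1_(`[k%:R / n.+1%:R, k.+1%:R / n.+1%:R[%classic) s.

Let stepE n N (s : R) : 0 <= s -> s < N%:R ->
  step n N s = f ((Num.truncn (s * n.+1%:R)).+1%:R / n.+1%:R).
Proof.
move=> s0 sN; set k := Num.truncn _.
have sn0 : 0 <= s * n.+1%:R by rewrite mulr_ge0.
have /andP[k1 k2] := truncn_itv sn0; rewrite -/k in k1 k2.
have kN : (k < N * n.+1)%N.
  by rewrite -(ltr_nat R) (le_lt_trans k1)// natrM ltr_pM2r.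
rewrite /step (bigD1 (Ordinal kN))//= [X in _ + X]big1 => [|i ik].
  rewrite addr0 indicE mem_set ?mulr1//= in_itv/= ler_pdivrMr// k1/=.
  by rewrite ltr_pdivlMr.
rewrite indicE memNset ?mulr0//= in_itv/= ler_pdivrMr// ltr_pdivlMr//.
move=> ik2; move: ik; rewrite -val_eqE/= => /eqP; apply.
by rewrite -(truncn_def ik2).
Qed.

Let step_point n N (s : R) : 0 <= s -> s < N%:R ->
  let t : R := (Num.truncn (s * n.+1%:R)).+1%:R / n.+1%:R in
  [/\ s < t, t <= s + n.+1%:R^-1 & t <= N%:R].
Proof.
move=> s0 sN /=; set k := Num.truncn _.
have sn0 : 0 <= s * n.+1%:R by rewrite mulr_ge0.
have /andP[k1 k2] := truncn_itv sn0; rewrite -/k in k1 k2.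
split.
- by rewrite ltr_pdivlMr.
- by rewrite ler_pdivrMr// mulrDl mulVf// -natr1 lerD2r.
- rewrite ler_pdivrMr// -natrM ler_nat.
  by rewrite -(ltr_nat R) (le_lt_trans k1)// natrM ltr_pM2r.
Qed.

Let step_cvg N (s : R) : 0 <= s -> s < N%:R -> step n N s @[n --> \oo] --> f s.
Proof.
move=> s0 sN.
under eq_fun do rewrite stepE//.
pose t n : R := (Num.truncn (s * n.+1%:R)).+1%:R / n.+1%:R.
have tE n : [/\ s < t n, t n <= s + n.+1%:R^-1 & t n <= N%:R].
  exact: step_point.
have /cvg_at_rightP/(_ t) := cf.1 s s0; apply; split=> [n|].
  by have [] := tE n.
have cr : s + n.+1%:R^-1 @[n --> \oo] --> s.
  have := cvgD (cvg_cst s) (@cvg_harmonic R); rewrite addr0; exact.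
apply: (squeeze_cvgr _ (cvg_cst s) cr).
by apply: nearW => n; have [/ltW -> ->] := tE n.
Qed.

Let measurable_step n N : measurable_fun setT (step n N).
Proof.
by apply: measurable_sum => k; apply: measurable_funM.
Qed.

Lemma cadlag_measurable (N : nat) :
  measurable_fun (`[0, N%:R[%classic : set R) f.
Proof.
apply/measurable_EFinP.
apply: (@emeasurable_fun_cvg _ _ _ _ (fun n s => (step n N s)%:E)) => [n|s].
  by apply/measurable_EFinP; apply: (measurable_funS measurableT).
rewrite /= in_itv/= => /andP[s0 sN].
by apply: cvg_EFin; [exact: nearW|exact: step_cvg].
Qed.

(** The Riemann sum is exactly the integral of [step n N], and dominated convergence applies with
    the bound of the path on [[0, N]]. *)
Lemma riemann_cvg (N : nat) :
  ((n.+1%:R^-1 * \sum_(k < N * n.+1) f (k.+1%:R / n.+1%:R))%:E @[n --> \oo] -->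
   \int[mu]_(s in `[0%R, N%:R[) (f s)%:E)%E.
Proof.
have [M fM] := cadlag_bounded N%:R.
have mD : measurable (`[0, N%:R[%classic : set R) by [].
have intE n : (n.+1%:R^-1 * \sum_(k < N * n.+1) f (k.+1%:R / n.+1%:R))%:E =
    (\int[mu]_(s in `[0%R, N%:R[) (step n N s)%:E)%E.
  under eq_integral do rewrite -sumEFin.
  rewrite ge0_integral_sum//; last 2 first.
  - move=> k; apply/measurable_EFinP; apply: (measurable_funS measurableT) => //.
    by apply: measurable_funM.
  - by move=> k s _; rewrite lee_fin mulr_ge0// f0.
  rewrite mulr_sumr -sumEFin; apply: eq_bigr => k _.
  under eq_integral do rewrite EFinM.
  have ab : k%:R / n.+1%:R <= k.+1%:R / n.+1%:R :> R.
    by rewrite ler_pM2r ?invr_gt0// ler_nat.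
  rewrite (@ge0_integralZl_EFin _ _ _ mu _ mD);
    [|by move=> s _; rewrite lee_fin| |exact: f0].
  2: by apply/measurable_EFinP; apply: (measurable_funS measurableT).
  rewrite integral_indic// setIidl; last first.
    move=> s /=; rewrite !in_itv/= => /andP[ks sk]; apply/andP; split.
      by apply: le_trans ks; rewrite divr_ge0.
    apply: lt_le_trans sk _; rewrite ler_pdivrMr// -natrM ler_nat.
    exact: ltn_ord.
  rewrite /= lebesgue_measure_itv/= lte_fin ltr_pM2r ?invr_gt0// ltr_nat ltnSn.
  by rewrite -EFinB -EFinM -mulrBl -natrB// subSnn mul1r mulrC.
under eq_fun do rewrite intE.
have [] // := @dominated_convergence _ _ _ mu _ mD
  (fun n s => (step n N s)%:E) (fun s => (f s)%:E) (fun=> M%:E).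
- move=> n; apply/measurable_EFinP; apply: (measurable_funS measurableT) => //.
  exact: measurable_step.
- by apply/measurable_EFinP; exact: cadlag_measurable.
- apply: aeW => s; rewrite /= in_itv/= => /andP[s0 sN].
  by apply: cvg_EFin; [exact: nearW|exact: step_cvg].
- apply/integrableP; split; first exact: measurable_cst.
  rewrite integral_cst//= lebesgue_measure_itv/= lte_fin.
  case: ifP => _; rewrite ?mule0// -EFinB -EFinM ltry//.
- apply: aeW => s n; rewrite /= in_itv/= => /andP[s0 sN].
  rewrite lee_fin stepE//; have [/ltW st _ tN] := step_point n s0 sN.
  by apply: fM => //; exact: le_trans st.
Qed.

Lemma cadlag_integral_fin_num (N : nat) :
  (\int[mu]_(s in `[0%R, N%:R[) (f s)%:E)%E \is a fin_num.
Proof.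
have [M fM] := cadlag_bounded N%:R.
rewrite ge0_fin_numE; last first.
  by apply: integral_ge0 => s; rewrite /= in_itv/= => /andP[s0 _]; rewrite lee_fin f0.
have mD : measurable (`[0, N%:R[%classic : set R) by [].
apply: (@le_lt_trans _ _ (\int[mu]_(s in `[0%R, N%:R[) (cst M%:E) s)%E).
  apply: ge0_le_integral => //.
  - by move=> s; rewrite /= in_itv/= => /andP[s0 _]; rewrite lee_fin f0.
  - by apply/measurable_EFinP; exact: cadlag_measurable.
  - move=> s; rewrite /= in_itv/= => /andP[s0 sN]; rewrite lee_fin.
    by apply: le_trans (fM s s0 (ltW sN)); exact: ler_norm.
rewrite integral_cst//= lebesgue_measure_itv/= lte_fin.
by case: ifP => _; rewrite ?mule0// -EFinB -EFinM ltry.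
Qed.

(** Truncation moves all integrals to the common domain [[0, +oo[], as monotone convergence
    requires. *)
Let g (N : nat) : R -> \bar R := (EFin \o f) \_ (`[0, N%:R[%classic : set R).

Let gE N : (\int[mu]_(s in `[0%R, N%:R[) (f s)%:E =
  \int[mu]_(s in `[0%R, +oo[) g N s)%E.
Proof.
rewrite -integral_mkcondr setIidr// => s.
by rewrite /= !in_itv/= => /andP[->].
Qed.

Let g0 N s : (0 <= g N s)%E.
Proof.
apply: erestrict_ge0 => t; rewrite /= in_itv/= => /andP[t0 _].
by rewrite lee_fin f0.
Qed.

Let mg N : measurable_fun (`[0, +oo[%classic : set R) (g N).
Proof.
apply: (measurable_funS measurableT) => //.
apply/(measurable_restrictT _ (measurable_itv `[0, N%:R[)).
by apply/measurable_EFinP; exact: cadlag_measurable.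
Qed.

Let ndg s : nondecreasing_seq (g^~ s).
Proof.
move=> a b ab; rewrite /g !patchE; case: ifPn => [/set_mem/=|_].
  rewrite in_itv/= => /andP[s0 sa].
  by rewrite mem_set//= in_itv/= s0 (lt_le_trans sa)// ler_nat.
case: ifPn => // /set_mem/=; rewrite in_itv/= => /andP[s0 _].
by rewrite lee_fin f0.
Qed.

Lemma cadlag_integral_cvg :
  (\int[mu]_(s in `[0%R, N%:R[) (f s)%:E @[N --> \oo] -->
   \int[mu]_(s in `[0%R, +oo[) (f s)%:E)%E.
Proof.
under eq_fun do rewrite gE.
have -> : (\int[mu]_(s in `[0%R, +oo[) (f s)%:E =
    \int[mu]_(s in `[0%R, +oo[) limn (g^~ s))%E.
  apply: eq_integral => s /set_mem/=; rewrite in_itv/= andbT => s0.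
  apply/esym/cvg_lim => //; apply: cvg_near_cst.
  near=> N; rewrite /g patchE mem_set//= in_itv/= s0/=.
  by near: N; exact: nbhs_infty_gtr.
by apply: cvg_monotone_convergence.
Unshelve. all: by end_near. Qed.

Lemma cadlag_integral_le (N : nat) :
  (\int[mu]_(s in `[0%R, N%:R[) (f s)%:E <=
   \int[mu]_(s in `[0%R, +oo[) (f s)%:E)%E.
Proof.
rewrite -(cvg_lim _ cadlag_integral_cvg)//; apply: lime_ge.
  by apply/cvg_ex; eexists; exact: cadlag_integral_cvg.
exists N => // M /= NM; rewrite !gE; apply: ge0_le_integral => //.
- exact: mg.
- exact: mg.
- by move=> s _; exact: ndg.
Qed.

End riemann_sums.

(** * Laplace transform of the total mass *)

(** By the integral equation the quotient is the mean of [phi (u t)] over [[0, 1 / (n + 1)]], and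
    [u t] tends to [z] because the integral over [[0, t]] vanishes as [t] tends to 0. *)
Lemma cumulant_slope (R : realType) (phi u : R -> R) (z : R) :
  is_branching_mechanism phi -> 0 < z -> is_cumulant phi z u ->
  (z - u n.+1%:R^-1) * n.+1%:R @[n --> \oo] --> phi z.
Proof.
move=> hphi z0 hu; apply/cvgrPdist_le => e e0.
have cphi := branching_continuous hphi z0.
have [_ int1 _] := hu 1 ler01.
have /cvgrPdist_le/(_ _ e0)[r /= r0 hr] := cphi.
have near_u : \forall t \near (0 : R), 0 <= t -> `|phi z - phi (u t)| <= e.
  have h := parameterized_integral_near_left ltr01 r0 int1.
  apply: filterS h => t h t0; apply: hr => /=.
  have [_ _ ->] := hu t t0.
  by rewrite opprB addrC subrK; exact: h.
move: near_u => /nbhs_ballP[s /= s0 hs].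
near=> n.
have ns : n.+1%:R^-1 < s.
  near: n.
  have /cvgrPdist_lt/(_ _ s0) := @cvg_harmonic R.
  apply: filterS => n; rewrite sub0r normrN /harmonic/=.
  by rewrite ger0_norm// invr_ge0.
set h := n.+1%:R^-1 in ns *.
have h0 : 0 < h by rewrite invr_gt0.
have [_ inth ->] := hu h (ltW h0).
rewrite subKr.
have mI : measurable (`[0, h]%classic : set R) by [].
have intc (c : R) : lebesgue_measure.-integrable `[0, h] (EFin \o cst c).
  apply/integrableP; split; first by apply/measurable_EFinP; exact: measurable_cst.
  rewrite (_ : (fun x => _) = cst `|c%:E|%E)// integral_cst//=.
  by rewrite lebesgue_measure_itv/= lte_fin h0 -EFinB -EFinM ltry.
have hE : h * n.+1%:R = 1 by rewrite mulVf.
have cE (c : R) : \int[lebesgue_measure]_(t in `[0, h]) cst c t = c * h.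
  by rewrite Rintegral_cst//= lebesgue_measure_itv/= lte_fin h0/= subr0.
have -> : phi z - (\int[lebesgue_measure]_(t in `[0, h]) phi (u t)) * n.+1%:R =
    (\int[lebesgue_measure]_(t in `[0, h]) (phi z - phi (u t))) * n.+1%:R.
  rewrite RintegralB//; last exact: (intc (phi z)).
  by rewrite (cE (phi z)) mulrBl -mulrA hE mulr1.
rewrite normrM [X in _ * X]ger0_norm// -ler_pdivlMr//.
have intd : lebesgue_measure.-integrable `[0, h]
    (EFin \o (fun t => phi z - phi (u t))).
  rewrite (_ : _ \o _ = (fun t => (cst (phi z) t)%:E - (phi (u t))%:E)%E)//.
  by apply: integrableB => //; exact: (intc (phi z)).
apply: (@le_trans _ _ (\int[lebesgue_measure]_(t in `[0, h]) `|phi z - phi (u t)|)).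
  by apply: le_normr_Rintegral => //; exact: intd.
have -> : e / n.+1%:R = \int[lebesgue_measure]_(t in `[0, h]) cst e t.
  by rewrite cE.
apply: le_Rintegral.
- by [].
- exact: integrable_norm intd.
- exact: intc.
- move=> t; rewrite /= in_itv/= => /andP[t0 th]; apply: hs => //.
  by rewrite /ball/= sub0r normrN ger0_norm// (le_lt_trans th).
Unshelve. all: by end_near. Qed.

Lemma cvg_expectation_le1 d (T : measurableType d) (R : realType)
    (p : probability T R) (g_ : nat -> T -> R) (g : T -> R) :
  (forall n, measurable_fun setT (g_ n)) -> (forall n w, 0 <= g_ n w <= 1) ->
  (forall w, g_ n w @[n --> \oo] --> g w) ->
  (\int[p]_w (g_ n w)%:E @[n --> \oo] --> \int[p]_w (g w)%:E)%E.
Proof.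
move=> mg_ g01 g_g.
have mg : measurable_fun setT (EFin \o g).
  apply: (@emeasurable_fun_cvg _ _ _ _ (fun n w => (g_ n w)%:E)) => [n|w _].
    exact/measurable_EFinP.
  by apply: cvg_EFin; [exact: nearW|exact: g_g].
have [] // := @dominated_convergence _ _ _ p _ measurableT
  (fun n w => (g_ n w)%:E) (fun w => (g w)%:E) (cst 1%E).
- by move=> n; exact/measurable_EFinP.
- by apply: aeW => w _; apply: cvg_EFin; [exact: nearW|exact: g_g].
- apply/integrableP; split; first exact: measurable_cst.
  rewrite (eq_integral (cst 1%E)) => [|w _]; last by rewrite /= normr1.
  by rewrite integral_cst//= probability_setT mule1 ltry.
- apply: aeW => w n _; rewrite lee_fin; have /andP[h0 h1] := g01 n w.
  by rewrite ger0_norm.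
Qed.

(** * Two-sided bounds on the Laplace transform of the mass *)

Section total_mass.
Context (R : realType) (phi : R -> R) (hphi : is_branching_mechanism phi).
Context (P : R -> R.-pker R ~> R).
Context (d : measure_display) (Omega : measurableType d).
Context (F : R -> set (set Omega)) (X : R -> Omega -> R).
Context (Q : R -> probability Omega R) (hX : is_hunt_realization P F X Q).

Let hM := hunt_markov hX.

Let X0 w t : 0 <= t -> 0 <= X t w. Proof. exact: (markov_state hM). Qed.

Definition riemann_mass (n N : nat) (w : Omega) : R :=
  n.+1%:R^-1 * \sum_(k < N * n.+1) X (k.+1%:R / n.+1%:R) w.

Definition mass_upto (N : nat) (w : Omega) : R :=
  fine (\int[lebesgue_measure]_(s in `[0%R, N%:R[) (X s w)%:E).

Lemma mass_uptoE N w : (mass_upto N w)%:E =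
  (\int[lebesgue_measure]_(s in `[0%R, N%:R[) (X s w)%:E)%E.
Proof.
rewrite fineK//; apply: cadlag_integral_fin_num; first exact: (hunt_cadlag hX).
by move=> t; exact: X0.
Qed.

Lemma riemann_mass_ge0 n N w : 0 <= riemann_mass n N w.
Proof. by rewrite mulr_ge0// sumr_ge0// => k _; rewrite X0// divr_ge0. Qed.

Lemma measurable_riemann_mass n N : measurable_fun setT (riemann_mass n N).
Proof.
apply: measurable_funM => //; apply: measurable_sum => k.
by apply: (markov_measurable hM); rewrite divr_ge0.
Qed.

Lemma cvg_riemann_mass N w : riemann_mass n N w @[n --> \oo] --> mass_upto N w.
Proof.
have := @riemann_cvg _ _ (hunt_cadlag hX w) (@X0 w) N.
by rewrite -mass_uptoE => /fine_cvg.
Qed.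

Lemma mass_upto_ge0 N w : 0 <= mass_upto N w.
Proof.
apply: fine_ge0; apply: integral_ge0 => s; rewrite /= in_itv/= => /andP[s0 _].
by rewrite lee_fin X0.
Qed.

Lemma measurable_mass_upto N : measurable_fun setT (mass_upto N).
Proof.
apply: (measurable_fun_cvg (fun n => measurable_riemann_mass n N)) => w _.
exact: cvg_riemann_mass.
Qed.

Lemma cvg_mass_upto w : ((mass_upto N w)%:E @[N --> \oo] --> total_mass X w)%E.
Proof.
under eq_fun do rewrite mass_uptoE.
by apply: cadlag_integral_cvg; [exact: (hunt_cadlag hX)|exact: X0].
Qed.

Lemma mass_upto_le N w : ((mass_upto N w)%:E <= total_mass X w)%E.
Proof.
by rewrite mass_uptoE; apply: cadlag_integral_le; [exact: (hunt_cadlag hX)|exact: X0].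
Qed.

Lemma measurable_total_mass : measurable_fun setT (total_mass X).
Proof.
apply: (@emeasurable_fun_cvg _ _ _ _ (fun N w => (mass_upto N w)%:E)) => [N|w _].
  by apply/measurable_EFinP; exact: measurable_mass_upto.
exact: cvg_mass_upto.
Qed.

Lemma measurable_finite_total_mass : measurable [set w | (total_mass X w < +oo)%E].
Proof.
rewrite -[X in measurable X]setTI.
by apply: emeasurable_fun_infty_o => //; exact: measurable_total_mass.
Qed.

(* [exp(- theta * total_mass)] with the convention [0 * oo = oo] *)
Definition killed_exp (theta : R) (w : Omega) : R :=
  \1_[set w | (total_mass X w < +oo)%E] w * expR (- (theta * fine (total_mass X w))).

Lemma killed_exp01 (theta : R) w : 0 <= theta -> 0 <= killed_exp theta w <= 1.
Proof.
move=> t0; rewrite /killed_exp.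
have /andP[i0 i1] : 0 <= (\1_[set w | (total_mass X w < +oo)%E] w : R) <= 1.
  by rewrite indicE; case: (_ \in _); rewrite /= ?lexx ?ler01.
have e0 := expR_ge0 (- (theta * fine (total_mass X w))).
have e1 : expR (- (theta * fine (total_mass X w))) <= 1.
  rewrite -expR0 ler_expR oppr_le0 mulr_ge0// fine_ge0//.
  by apply: le_trans (mass_upto_le 0 w); rewrite lee_fin mass_upto_ge0.
by rewrite mulr_ge0//= mulr_ile1.
Qed.

Lemma measurable_killed_exp theta : measurable_fun setT (killed_exp theta).
Proof.
apply: measurable_funM.
  by apply: measurable_indic; exact: measurable_finite_total_mass.
apply: measurableT_comp; first exact: measurable_expR.
apply: measurableT_comp => //; apply: measurable_funM => //.
exact: measurableT_comp measurable_total_mass.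
Qed.

Lemma cvg_killed_exp (u : nat -> R) (theta : R) w : u n @[n --> \oo] --> theta ->
  killed_exp (u n) w @[n --> \oo] --> killed_exp theta w.
Proof.
move=> ut; apply: cvgM; first exact: cvg_cst.
apply: continuous_cvg; first exact: continuous_expR.
by apply: cvgN; apply: cvgM => //; exact: cvg_cst.
Qed.

Lemma killed_expE theta w : 0 < theta ->
  (killed_exp theta w)%:E = expeR (- (theta%:E * total_mass X w))%E.
Proof.
move=> t0; rewrite /killed_exp indicE.
have m0 : (0 <= total_mass X w)%E.
  by apply: le_trans (mass_upto_le 0 w); rewrite lee_fin mass_upto_ge0.
have [moo|] := ltP (total_mass X w) +oo%E.
  rewrite mem_set//= mul1r -[in RHS](@fineK _ (total_mass X w)); last first.
    by rewrite ge0_fin_numE.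
  by rewrite -EFinM.
rewrite leye_eq => /eqP moo; rewrite memNset/= ?moo// mul0r.
by rewrite gt0_muley ?lte_fin.
Qed.

Variable v : R -> R -> R.
Hypothesis v_cumulant : forall lambda : R, 0 <= lambda ->
  is_cumulant phi lambda (v^~ lambda).
Hypothesis v_laplace : forall lambda : R, 0 <= lambda ->
  forall t x : R, 0 <= t -> 0 <= x ->
  (\int[P t x]_(y in `[0%R, +oo[) (expR (- (lambda * y)))%:E
     = (expR (- (x * v t lambda)))%:E)%E.

Variables (x z : R).
Hypotheses (x0 : 0 <= x) (z0 : 0 < z).

Let delta n := z - v n.+1%:R^-1 z.

Let martingale n k :
  (\int[Q x]_w (expR (- (z * X (k%:R / n.+1%:R) w +
      delta n * \sum_(j < k) X (j%:R / n.+1%:R) w)))%:E = (expR (- (x * z)))%:E)%E.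
Proof.
by rewrite /delta (discrete_martingale hM v_laplace)// ?ltW// invr_ge0.
Qed.

(** The martingale sums left endpoints and [riemann_mass] right endpoints; the two differ by
    boundary terms. *)
Let sum_shift n m w :
  \sum_(j < m.+1) X (j%:R / n.+1%:R) w =
  X 0 w + \sum_(k < m) X (k.+1%:R / n.+1%:R) w.
Proof. by rewrite big_ord_recl/= mul0r. Qed.

Let mX n k : measurable_fun setT (X (k%:R / n.+1%:R)).
Proof. by apply: (markov_measurable hM); rewrite divr_ge0. Qed.

(** The terminal term [z * X] dominates [delta n * X], which completes the left-endpoint sum by its
    last point; dropping [X 0 w >= 0] leaves the right-endpoint sum. *)
Lemma expectation_riemann_ge n N : 0 <= delta n ->
  ((expR (- (x * z)))%:E <=
   \int[Q x]_w (expR (- (delta n * n.+1%:R * riemann_mass n N w)))%:E)%E.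
Proof.
move=> d0; rewrite -(martingale n (N * n.+1)).
have mexp (g : Omega -> R) : measurable_fun setT g ->
    measurable_fun setT (fun w => (expR (- g w))%:E).
  move=> mg; apply/measurable_EFinP.
  by apply: measurableT_comp; [exact: measurable_expR|exact: measurableT_comp].
apply: ge0_le_integral => //.
- apply: mexp; apply: measurable_funD; apply: measurable_funM => //.
  by apply: measurable_sum => j; exact: mX.
- by apply: mexp; apply: measurable_funM => //; exact: measurable_riemann_mass.
move=> w _; rewrite lee_fin ler_expR lerN2 /riemann_mass.
rewrite -mulrA (mulrA n.+1%:R) mulfV// mul1r.
have := sum_shift n (N * n.+1) w; rewrite big_ord_recr/=.
set S := \sum_(j < _) _; set T := \sum_(k < _) _; set Y := X _ w => ST.
have Y0 : 0 <= Y by rewrite X0// divr_ge0.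
have X00 : 0 <= X 0 w by rewrite X0.
(* Nonnegativity of the cumulant [v]. *)
have dz : delta n <= z.
  have [] := v_cumulant (ltW z0) (t := n.+1%:R^-1); first by rewrite invr_ge0.
  by rewrite /delta => + _ _; lra.
have -> : T = S + Y - X 0 w by lra.
nra.
Qed.

(** Jensen's inequality for a uniform average: each term lies above the tangent at the mean [a], and
    the linear parts sum to 0. *)
Lemma exp_mean_le m (y : 'I_m.+1 -> R) :
  m.+1%:R * expR (- (m.+1%:R^-1 * \sum_k y k)) <= \sum_k expR (- y k).
Proof.
set a := m.+1%:R^-1 * _.
have aE : \sum_k y k = m.+1%:R * a by rewrite /a mulrA mulfV// mul1r.
apply: (@le_trans _ _ (\sum_(k < m.+1) expR (- a) * (1 + (a - y k)))); last first.
  apply: ler_sum => k _.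
  have -> : expR (- y k) = expR (- a) * expR (a - y k) by rewrite -expRD addKr.
  by apply: ler_wpM2l; [exact: expR_ge0|exact: expR_ge1Dx].
rewrite -mulr_sumr big_split/= sumr_const card_ord big_split/= sumr_const card_ord.
by rewrite sumrN aE -[a *+ _]mulr_natl subrr addr0 mulrC.
Qed.

(** The martingale is averaged over the times [k = 1, ..., m + 1]. Replacing its partial sums by the
    full sum [c w] leaves only [z * X] depending on [k], whose average is [z / N.+1] times the
    Riemann mass. *)
Lemma expectation_riemann_le n N :
  (\int[Q x]_w (expR (- (Num.max (delta n * n.+1%:R) 0 *
      (riemann_mass n N.+1 w + n.+1%:R^-1 * X 0 w) +
      z / N.+1%:R * riemann_mass n N.+1 w)))%:E <= (expR (- (x * z)))%:E)%E.
Proof.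
(* [delta n] may be negative; with [D >= 0] enlarging a partial sum can only increase the
   exponent. *)
pose D := Num.max (delta n) 0.
have D0 : 0 <= D by rewrite le_max lexx orbT.
have dD : delta n <= D by rewrite le_max lexx.
have DE : Num.max (delta n * n.+1%:R) 0 = D * n.+1%:R.
  by rewrite /D maxr_pMl// mul0r.
pose m := (N.+1 * n.+1).-1.
have mE : m.+1 = (N.+1 * n.+1)%N by rewrite /m prednK// muln_gt0.
pose T w := \sum_(k < m.+1) X (k.+1%:R / n.+1%:R) w.
have TE w : riemann_mass n N.+1 w = n.+1%:R^-1 * T w.
  by rewrite /riemann_mass /T mE.
pose c w := D * (X 0 w + T w).
have expE w : Num.max (delta n * n.+1%:R) 0 *
      (riemann_mass n N.+1 w + n.+1%:R^-1 * X 0 w) +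
      z / N.+1%:R * riemann_mass n N.+1 w =
    m.+1%:R^-1 * \sum_(k < m.+1) (c w + z * X (k.+1%:R / n.+1%:R) w).
  rewrite big_split/= sumr_const card_ord -mulr_sumr -/(T w) -[c w *+ _]mulr_natl.
  rewrite TE DE mE natrM /c; field.
  by rewrite !(addrC 1) !natr1 !pnatr_eq0.
have mT : measurable_fun setT T by apply: measurable_sum => k; exact: mX.
have mX0 : measurable_fun setT (X 0) by exact: (markov_measurable hM).
have mc : measurable_fun setT c by apply: measurable_funM => //; exact: measurable_funD.
have mexp (g : Omega -> R) : measurable_fun setT g ->
    measurable_fun setT (fun w => (expR (- g w))%:E).
  move=> mg; apply/measurable_EFinP.
  by apply: measurableT_comp; [exact: measurable_expR|exact: measurableT_comp].
have term k : (k <= m)%N -> (\int[Q x]_w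
    (expR (- (c w + z * X (k.+1%:R / n.+1%:R) w)))%:E <= (expR (- (x * z)))%:E)%E.
  move=> km; rewrite -(martingale n k.+1); apply: ge0_le_integral => //.
  - by apply: mexp; apply: measurable_funD => //; exact: measurable_funM.
  - apply: mexp; apply: measurable_funD; apply: measurable_funM => //.
    by apply: measurable_sum => j; exact: mX.
  move=> w _; rewrite lee_fin ler_expR lerN2 addrC lerD2r /c -(sum_shift n m.+1).
  have S0 : 0 <= \sum_(j < k.+1) X (j%:R / n.+1%:R) w.
    by apply: sumr_ge0 => j _; rewrite X0// divr_ge0.
  apply: (@le_trans _ _ (D * \sum_(j < k.+1) X (j%:R / n.+1%:R) w)).
    exact: ler_wpM2r.
  apply: ler_wpM2l => //.
  rewrite -(big_mkord xpredT (fun j => X (j%:R / n.+1%:R) w)).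
  rewrite -(big_mkord xpredT (fun j => X (j%:R / n.+1%:R) w)).
  rewrite [leRHS](@big_cat_nat _ _ _ k.+1)//= ?lerDl; last by rewrite ltnS ltnW.
  by apply: sumr_ge0 => j _; rewrite X0// divr_ge0.
rewrite -(@lee_pmul2l _ m.+1%:R%:E) ?lte_fin//.
rewrite -ge0_integralZl_EFin//; last first.
  under eq_fun do rewrite expE.
  apply: mexp; apply: measurable_funM => //; apply: measurable_sum => k.
  by apply: measurable_funD => //; exact: measurable_funM.
apply: (@le_trans _ _ (\int[Q x]_w \sum_(k < m.+1)
    (expR (- (c w + z * X (k.+1%:R / n.+1%:R) w)))%:E)%E).
  apply: ge0_le_integral => //.
  - apply: measurable_funeM; under eq_fun do rewrite expE.
    apply: mexp; apply: measurable_funM => //; apply: measurable_sum => k.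
    by apply: measurable_funD => //; exact: measurable_funM.
  - apply: emeasurable_sum => k; apply: mexp.
    by apply: measurable_funD => //; exact: measurable_funM.
  - by move=> w _; rewrite sumEFin -EFinM lee_fin expE exp_mean_le.
rewrite ge0_integral_sum//; last first.
  by move=> k; apply: mexp; apply: measurable_funD => //; exact: measurable_funM.
apply: (@le_trans _ _ (\sum_(k < m.+1) (expR (- (x * z)))%:E)%E).
  by apply: lee_sum => k _; apply: term; rewrite -ltnS.
by rewrite sumEFin sumr_const card_ord -[_ *+ m.+1]mulr_natl EFinM.
Qed.

Let measurable_expRN (g : Omega -> R) : measurable_fun setT g ->
  measurable_fun setT (fun w => expR (- g w)).
Proof.
by move=> mg; apply: measurableT_comp; [exact: measurable_expR|exact: measurableT_comp].
Qed.

Let expRN01 (y : R) : 0 <= y -> 0 <= expR (- y) <= 1.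
Proof. by move=> y0; rewrite expR_ge0/= -expR0 ler_expR oppr_le0. Qed.

Let cvg_expRN (u : nat -> R) (l : R) : u n @[n --> \oo] --> l ->
  expR (- u n) @[n --> \oo] --> expR (- l).
Proof. by move=> ul; apply: continuous_cvg; [exact: continuous_expR|exact: cvgN]. Qed.

Let cvg_slope : delta n * n.+1%:R @[n --> \oo] --> phi z.
Proof. exact: (cumulant_slope hphi z0 (v_cumulant (ltW z0))). Qed.

Let cvg_slope_max :
  Num.max (delta n * n.+1%:R) 0 @[n --> \oo] --> Num.max (phi z) 0.
Proof.
apply: (@continuous_cvg _ _ _ _ _ _ (fun a : R => Num.max a 0)) cvg_slope.
by apply: continuous_max; [exact: cvg_id|exact: cvg_cst].
Qed.

Let max0 (a : R) : 0 <= Num.max a 0. Proof. by rewrite le_max lexx orbT. Qed.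

Lemma expectation_mass_upto_ge N : 0 < phi z ->
  ((expR (- (x * z)))%:E <= \int[Q x]_w (expR (- (phi z * mass_upto N w)))%:E)%E.
Proof.
move=> pz.
have cR w : Num.max (delta n * n.+1%:R) 0 * riemann_mass n N w
    @[n --> \oo] --> phi z * mass_upto N w.
  (* The maximum with 0 keeps the approximating exponentials in [[0, 1]] for every [n]; it is
     inactive for large [n]. *)
  have <- : Num.max (phi z) 0 = phi z by apply/max_l/ltW.
  apply: cvgM; first exact: cvg_slope_max.
  exact: cvg_riemann_mass.
have h := @cvg_expectation_le1 _ _ _ (Q x)
  (fun n w => expR (- (Num.max (delta n * n.+1%:R) 0 * riemann_mass n N w)))
  (fun w => expR (- (phi z * mass_upto N w))).
apply: (cvge_to_ge (h _ _ _)) => [n|n w|w|].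
- apply: measurable_expRN; apply: measurable_funM => //; exact: measurable_riemann_mass.
- by apply: expRN01; rewrite mulr_ge0// riemann_mass_ge0.
- exact: cvg_expRN.
- near=> n.
  have /ltW a0 : 0 < delta n * n.+1%:R.
    by near: n; exact: (@cvgr_gt _ _ _ _ _ _ cvg_slope _ pz).
  rewrite (max_l a0); apply: expectation_riemann_ge.
  by move: a0; rewrite pmulr_lge0.
Unshelve. all: by end_near. Qed.

Lemma expectation_mass_upto_le N :
  (\int[Q x]_w (expR (- ((Num.max (phi z) 0 + z / N.+1%:R) * mass_upto N.+1 w)))%:E
   <= (expR (- (x * z)))%:E)%E.
Proof.
have cR w : Num.max (delta n * n.+1%:R) 0 *
      (riemann_mass n N.+1 w + n.+1%:R^-1 * X 0 w) +
      z / N.+1%:R * riemann_mass n N.+1 w @[n --> \oo] -->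
    (Num.max (phi z) 0 + z / N.+1%:R) * mass_upto N.+1 w.
  have cr := @cvg_riemann_mass N.+1 w.
  rewrite mulrDl; apply: cvgD; last by apply: cvgM => //; exact: cvg_cst.
  apply: cvgM; first exact: cvg_slope_max.
  rewrite -[X in _ --> X]addr0; apply: cvgD => //.
  rewrite -[X in _ --> X](mul0r (X 0 w)); apply: cvgM; last exact: cvg_cst.
  exact: cvg_harmonic.
have := @cvg_expectation_le1 _ _ _ (Q x)
  (fun n w => expR (- (Num.max (delta n * n.+1%:R) 0 *
      (riemann_mass n N.+1 w + n.+1%:R^-1 * X 0 w) +
      z / N.+1%:R * riemann_mass n N.+1 w)))
  (fun w => expR (- ((Num.max (phi z) 0 + z / N.+1%:R) * mass_upto N.+1 w))).
move=> h; apply: (cvge_to_le (h _ _ _)) => [n|n w|w|].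
- apply: measurable_expRN; apply: measurable_funD; apply: measurable_funM => //.
    apply: measurable_funD; first exact: measurable_riemann_mass.
    by apply: measurable_funM => //; exact: (markov_measurable hM).
  exact: measurable_riemann_mass.
- apply: expRN01; rewrite addr_ge0// mulr_ge0 ?riemann_mass_ge0//.
  + by rewrite addr_ge0 ?riemann_mass_ge0// mulr_ge0 ?invr_ge0// X0.
  + by rewrite divr_ge0// ltW.
- exact: cvg_expRN.
- by apply: nearW => n; exact: expectation_riemann_le.
Qed.

(** Both sides of the comparison use the rate [u n]: on infinite mass [killed_exp] is 0, elsewhere
    [mass_upto] is at most the total mass. The excess [z / (n + 1)] then tends to 0. *)
Lemma expectation_killed_exp_le :
  (\int[Q x]_w (killed_exp (Num.max (phi z) 0) w)%:E <= (expR (- (x * z)))%:E)%E.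
Proof.
pose u n : R := Num.max (phi z) 0 + z / n.+1%:R.
have u0 n : 0 <= u n.
  by rewrite addr_ge0 ?divr_ge0// ?(ltW z0)// le_max lexx orbT.
have cu : u n @[n --> \oo] --> Num.max (phi z) 0.
  rewrite -[X in _ --> X]addr0; apply: cvgD; first exact: cvg_cst.
  rewrite -[X in _ --> X](mulr0 z); apply: cvgM; first exact: cvg_cst.
  exact: cvg_harmonic.
have h := @cvg_expectation_le1 _ _ _ (Q x) (fun n => killed_exp (u n)) _
  (fun n => measurable_killed_exp (u n)) (fun n w => killed_exp01 w (u0 n))
  (fun w => @cvg_killed_exp u _ w cu).
apply: (cvge_to_le h); apply: nearW => n.
apply: le_trans (expectation_mass_upto_le n); apply: ge0_le_integral => //.
- by move=> w _; rewrite lee_fin; have /andP[] := killed_exp01 w (u0 n).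
- by apply/measurable_EFinP; exact: measurable_killed_exp.
- apply/measurable_EFinP; apply: measurable_expRN; apply: measurable_funM => //.
  exact: measurable_mass_upto.
move=> w _; rewrite lee_fin /killed_exp indicE.
have [moo|moo] := boolP (w \in _); last by rewrite mul0r expR_ge0.
rewrite mul1r ler_expR lerN2; apply: ler_wpM2l; first exact: u0.
rewrite -lee_fin (@fineK _ (total_mass X w)) ?mass_upto_le//.
move/set_mem : moo => /= moo; rewrite ge0_fin_numE//.
by apply: le_trans (mass_upto_le 0 w); rewrite lee_fin mass_upto_ge0.
Qed.

(** Positivity of [phi z] sends the exponential to 0 on infinite mass, so the limit there agrees
    with [killed_exp]. *)
Lemma expectation_killed_exp_ge : 0 < phi z ->
  ((expR (- (x * z)))%:E <= \int[Q x]_w (killed_exp (phi z) w)%:E)%E.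
Proof.
move=> pz.
have h := @cvg_expectation_le1 _ _ _ (Q x)
  (fun N w => expR (- (phi z * mass_upto N w))) (killed_exp (phi z)).
apply: (cvge_to_ge (h _ _ _)) => [N|N w|w|].
- apply: measurable_expRN; apply: measurable_funM => //.
  exact: measurable_mass_upto.
- by apply: expRN01; rewrite mulr_ge0 ?(ltW pz)// mass_upto_ge0.
- have m0 : (0 <= total_mass X w)%E.
    by apply: le_trans (mass_upto_le 0 w); rewrite lee_fin mass_upto_ge0.
  have cw := @cvg_mass_upto w.
  rewrite /killed_exp indicE.
  have [moo|] := ltP (total_mass X w) +oo%E.
    rewrite mem_set//= mul1r; apply: cvg_expRN; apply: cvgM; first exact: cvg_cst.
    have fm : total_mass X w \is a fin_num by rewrite ge0_fin_numE.
    by move: cw; rewrite -[total_mass X w]fineK// => /fine_cvg.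
  rewrite leye_eq => /eqP moo; rewrite memNset/= ?moo// mul0r.
  rewrite moo in cw; move/cvgeryP in cw.
  apply: (cvg_comp _ _ _ (@cvgr_expR R)).
  apply/cvgryPge => A; move/cvgryPge/(_ (A / phi z)) : cw.
  by apply: filterS => N; rewrite ler_pdivrMr// mulrC.
- by apply: nearW => N; exact: expectation_mass_upto_ge.
Qed.

End total_mass.

(** * Conclusion in the two slope regimes *)

Theorem theorem4p8 (R : realType) (phi : R -> R)
    (hphi : is_branching_mechanism phi)
    (P : R -> R.-pker R ~> R) (hP : is_cb_semigroup phi P)
    (d : measure_display) (Omega : measurableType d)
    (F : R -> set (set Omega)) (X : R -> Omega -> R)
    (Q : R -> probability Omega R) (hX : is_hunt_realization P F X Q) :
  ((0 < dphi_infty phi)%E ->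
     forall x theta : R, 0 < x -> 0 < theta ->
       (\int[Q x]_w expeR (- (theta%:E * total_mass X w))
          = (expR (- (x * phi_inv phi theta)))%:E)%E /\
       Q x [set w | (total_mass X w < +oo)%E]
         = (expR (- (x * phi_inv phi 0)))%:E) /\
  ((dphi_infty phi <= 0)%E ->
     forall x : R, 0 < x ->
       Q x [set w | (total_mass X w < +oo)%E] = 0%E).
Proof.
have [v hv] := cb_laplace hP.
have v_cumulant lambda (l0 : 0 <= lambda) := (hv lambda l0).1.
have v_laplace lambda (l0 : 0 <= lambda) := (hv lambda l0).2.
have E_le (x z : R) : 0 < x -> 0 < z ->
    (\int[Q x]_w (killed_exp X (Num.max (phi z) 0) w)%:E <= (expR (- (x * z)))%:E)%E.
  by move=> /ltW x0 z0; apply: (expectation_killed_exp_le hphi hX v_cumulant v_laplace).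
have E_ge (x z : R) : 0 < x -> 0 < z -> 0 < phi z ->
    ((expR (- (x * z)))%:E <= \int[Q x]_w (killed_exp X (phi z) w)%:E)%E.
  by move=> /ltW x0 z0; apply: (expectation_killed_exp_ge hphi hX v_cumulant v_laplace).
(* At rate 0 [killed_exp] is the indicator of finite total mass. *)
have Q_finite x : (Q x [set w | total_mass X w < +oo] =
    \int[Q x]_w (killed_exp X 0 w)%:E)%E.
  rewrite -[X in Q x X]setIT -integral_indic//; last first.
    exact: (measurable_finite_total_mass hX).
  by apply: eq_integral => w _; rewrite /killed_exp mul0r oppr0 expR0 mulr1.
split=> [slope x theta x0 theta0|slope x x0].
(* At [z = phi_inv phi t] one has [phi z = t > 0], so the upper and the lower bound coincide. *)
- have E_eq t : 0 < t -> (\int[Q x]_w (killed_exp X t w)%:E =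
      (expR (- (x * phi_inv phi t)))%:E)%E.
    move=> t0; have q0 := phi_inv_gt0 hphi slope t0.
    have qE := phi_invK hphi slope t0.
    apply/le_anti/andP; split.
      have := E_le x _ x0 q0; rewrite qE max_l//; exact: ltW.
    by have := E_ge x _ x0 q0; rewrite qE; exact.
  split.
    rewrite -E_eq//; apply: eq_integral => w _.
    by rewrite (killed_expE hX).
  rewrite Q_finite.
  (* The rate tends to 0 along [1 / (n + 1)]; both sides of [E_eq] converge and their limits are
     compared. *)
  have n0 n : 0 < n.+1%:R^-1 :> R by rewrite invr_gt0.
  have inv0 : n.+1%:R^-1 @[n --> \oo] --> (0 : R) by exact: cvg_harmonic.
  have c1 := @cvg_expectation_le1 _ _ _ (Q x) (fun n => killed_exp X n.+1%:R^-1) _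
    (fun n => measurable_killed_exp hX _) (fun n w => killed_exp01 hX w _)
    (fun w => @cvg_killed_exp _ _ _ X _ _ w inv0).
  have c2 : ((expR (- (x * phi_inv phi n.+1%:R^-1)))%:E @[n --> \oo] -->
      (expR (- (x * phi_inv phi 0)))%:E)%E.
    apply: cvg_EFin; first exact: nearW.
    apply: continuous_cvg; first exact: continuous_expR.
    apply: cvgN; apply: cvgM; first exact: cvg_cst.
    apply/cvgrPdist_le => e e0.
    have [eta eta0 he] := phi_inv_cvg0 hphi slope e0.
    have /cvgrPdist_lt/(_ _ eta0) := inv0.
    apply: filterS => n; rewrite sub0r normrN ger0_norm ?invr_ge0// => ne.
    have /andP[h1 h2] := he _ (n0 n) ne.
    by rewrite distrC ger0_norm; lra.
  have := c1 (fun n => ltW (n0 n)).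
  under eq_fun do rewrite E_eq//.
  by move=> {}c1; exact: (cvg_unique _ c1 c2).
- apply/le_anti/andP; split; last exact: measure_ge0.
  apply/lee_addgt0Pr => e e0; rewrite add0e Q_finite.
  (* With [z = 1 / (x * e)] the bound [expR (- (x * z))] is [expR (- e^-1)], at most [e] since
     [expR e^-1 >= e^-1]. *)
  have z0 : 0 < (x * e)^-1 by rewrite invr_gt0 mulr_gt0.
  have pz := branching_nonpos hphi slope z0.
  have := E_le x _ x0 z0; rewrite max_r// => /le_trans; apply.
  rewrite lee_fin invfM mulrA mulfV ?gt_eqF// mul1r expRN.
  have e1 := expR_ge1Dx e^-1.
  rewrite -[leRHS]invrK lef_pV2 ?posrE ?expR_gt0 ?invr_gt0//; lra.
Qed.
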